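(* Let $u$ be an inner function with Clark measures $\{\sigma_\alpha\}_{\alpha\in\mathbb{T}}$, and let $f\in H^2$. Then $$d\mu_{T_u,f}(\alpha) = \Big(\int_{\mathbb{T}} |f(\xi)|^2\,d\sigma_\alpha(\xi)\Big)\,dm(\alpha).$$
   Context: $H^2$ is the Hardy space on the unit disk, functions identified with boundary values on $\mathbb{T}$; $m$ is normalized Lebesgue measure on $\mathbb{T}$; $P_\lambda(\xi)=\frac{1-|\lambda|^2}{|\xi-\lambda|^2}$ is the Poisson kernel. For an inner function $u$ and $\alpha\in\mathbb{T}$, the Clark measure $\sigma_\alpha$ is the unique positive measure on $\mathbb{T}$ with $\frac{1-|u(z)|^2}{|\alpha-u(z)|^2}=\int_{\mathbb{T}}P_z(\xi)\,d\sigma_\alpha(\xi)$ for $z\in\mathbb{D}$. By Aleksandrov's disintegration theorem, for $g\in L^1(m)$ the integral $\int g\,d\sigma_\alpha$ is well defined for $m$-a.e. $\alpha$, is $m$-integrable in $\alpha$, and $\int_{\mathbb{T}}\int_{\mathbb{T}} g\,d\sigma_\alpha\,dm(\alpha)=\int_{\mathbb{T}} g\,dm$. $T_uf=uf$ on $H^2$. For a contraction $T$ on a Hilbert space, $K_\lambda(T)=(I-\lambda T^* )^{-1}+(I-\overline{\lambda}T)^{-1}-I$ ($\lambda\in\mathbb{D}$), and $\mu_{T,\mathbf{x}}$ is the unique positive finite Borel measure on $\mathbb{T}$ with $\langle K_\lambda(T)\mathbf{x},\mathbf{x}\rangle=\int_{\mathbb{T}}P_\lambda\,d\mu_{T,\mathbf{x}}$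 for all $\lambda\in\mathbb{D}$. *)

(* Defs.v *)
From HB Require Import structures.
From mathcomp Require Import all_boot all_order all_algebra.
From mathcomp Require Import all_classical all_reals all_analysis.
From mathcomp Require Import complex.

Set Implicit Arguments.
Unset Strict Implicit.
Unset Printing Implicit Defensive.

Import Order.TTheory GRing.Theory Num.Theory.
Import numFieldNormedType.Exports.

Local Open Scope classical_set_scope.
Local Open Scope ring_scope.

(* Conventions: the unit circle T is parametrized by the angle
   t in Dom = [0, 2 pi[, via t |-> expi t = e^{it}.  Functions on T are
   functions R -> R[i] (only their values on Dom matter).  The normalized
   Lebesgue measure m on T is (2 pi)^-1 times Lebesgue measure on Dom. *)

Section Defs.
Variable R : realType.

Definition Dom : set R := `[0, 2 * pi[%classic.

Definition expi (t : R) : R[i] := (cos t +i* sin t)%C.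

Definition sqnorm (z : R[i]) : R := complex.Re z ^+ 2 + complex.Im z ^+ 2.

Definition mint (g : R -> \bar R) : \bar R :=
  (((2 * pi)^-1)%:E * \int[lebesgue_measure]_(t in Dom) g t)%E.

Definition mRint (g : R -> R) : R :=
  (2 * pi)^-1 * \int[lebesgue_measure]_(t in Dom) g t.

Definition mCint (g : R -> R[i]) : R[i] :=
  (mRint (fun t => complex.Re (g t)) +i* mRint (fun t => complex.Im (g t)))%C.

Definition cmeasurable (g : R -> R[i]) : Prop :=
  measurable_fun Dom (fun t => complex.Re (g t)) /\ measurable_fun Dom (fun t => complex.Im (g t)).

Definition ae_T (P : R -> Prop) : Prop :=
  lebesgue_measure.-negligible (Dom `&` [set t | ~ P t]).

(* the Hardy space H^2, as boundary functions: square integrable with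
   vanishing negative Fourier coefficients  \hat g(-n) = int g xi^n dm *)
Definition H2 (g : R -> R[i]) : Prop :=
  [/\ cmeasurable g,
      (mint (fun t => (sqnorm (g t))%:E) < +oo)%E &
      forall n : nat, (0 < n)%N -> mCint (fun t => g t * expi t ^+ n) = 0].

Definition ip (g h : R -> R[i]) : R[i] := mCint (fun t => g t * conjc (h t)).

(* inner function (boundary values): in H^infty (here: H^2 with |u| = 1 a.e.) *)
Definition inner_fun (u : R -> R[i]) : Prop :=
  H2 u /\ ae_T (fun t => sqnorm (u t) = 1).

Definition nonconstant (u : R -> R[i]) : Prop :=
  ~ (exists c : R[i], ae_T (fun t => u t = c)).

Definition poisson (z : R[i]) (t : R) : R :=
  (1 - sqnorm z) / sqnorm (expi t - z).

(* value at z in the disc of the function with boundary values u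
   (Poisson integral) *)
Definition ext (u : R -> R[i]) (z : R[i]) : R[i] :=
  mCint (fun t => (poisson z t)%:C%C * u t).

(* sigma is the family of Clark measures of u: sigma a is the Clark
   measure at alpha = expi a (a in Dom), a positive measure on T (~ Dom) *)
Definition clark_family (u : R -> R[i])
    (sigma : R -> {measure set R -> \bar R}) : Prop :=
  forall a, Dom a -> forall z : R[i], sqnorm z < 1 ->
    ((1 - sqnorm (ext u z)) / sqnorm (expi a - ext u z))%:E =
    (\int[sigma a]_(t in Dom) (poisson z t)%:E)%E.

(* y = (I - lam T_u^* )^{-1} x in H^2, characterized weakly:
   for all g in H^2, <y - lam T_u^* y, g> = <y, g> - lam <y, T_u g> = <x, g> *)
Definition resolvent_adj (u : R -> R[i]) (lam : R[i]) (x y : R -> R[i]) : Prop :=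
  H2 y /\ forall g, H2 g -> ip y g - lam * ip y (fun t => u t * g t) = ip x g.

Definition resolvent (u : R -> R[i]) (lam : R[i]) (x z : R -> R[i]) : Prop :=
  H2 z /\ ae_T (fun t => z t - conjc lam * (u t * z t) = x t).

End Defs.
Arguments Dom {R}.

(* Main.v *)
Require Import Defs.
From HB Require Import structures.
From mathcomp Require Import all_boot all_order all_algebra.
From mathcomp Require Import all_classical all_reals all_analysis.
From mathcomp Require Import measurable_realfun complex ring lra.

Set Implicit Arguments.
Unset Strict Implicit.
Unset Printing Implicit Defensive.

Import Order.TTheory GRing.Theory Num.Theory.
Import numFieldNormedType.Exports.
Local Open Scope classical_set_scope.
Local Open Scope ring_scope.

(** For [lam] in the disc put [P_lam(u) = (1 - |lam|^2) / |u - lam|^2] on the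
    circle.  The Poisson integral is multiplicative on bounded analytic functions,
    so the image of the measure [P_w dm] under [u] is [P_(u(w)) dm], whose density
    at [alpha] is [int P_w dsigma_alpha] by definition of the Clark measures.
    Hence the identity
      [int P_lam(alpha) (int g dsigma_alpha) dm(alpha) = int P_lam(u) g dm]
    holds for the Poisson kernels [g = P_w].  It passes to linear combinations and
    to bounded pointwise limits, hence first to trigonometric polynomials (expand
    [P_(r e^is)] in powers of [r]), and then to all bounded Borel functions, and
    by monotone convergence to [g = |f|^2].  On the other hand [|u| = 1] and
    [z = f / (1 - conj(lam) u)] give [2 Re <z, f> - <f, f> = int P_lam(u) |f|^2 dm],
    and testing the adjoint resolvent [y] against [z] gives [<y, f> = <f, z>]. *)

(** * Complex numbers *)

(** All functions are given by boundary values and Fourier conditions, so the multiplicativity of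
    the Poisson integral is reached by approximating one factor in L^2 by polynomials in xi, for
    which it is algebra. The definition of a Clark family treats each alpha separately;
    measurability of alpha -> int g dsigma_alpha is therefore carried along with the disintegration
    identity. A Clark measure may charge m-null sets, so functions integrated against it are bounded
    at every point of the circle, and only [u] is modified on a null set: it enters the definition
    of sigma_alpha through its Poisson integral alone. Nonconstancy of [u] enters through |u(w)| <
    1. For a constant u = c the measure mu_{T_u,f} is ||f||^2 times the point mass at c, which has
    no density when f is not zero. One monotone class theorem serves twice, for the L^2 density of
    trigonometric polynomials and for the disintegration. *)

Section complex_facts.
Variable R : realType.
Implicit Types z w c v : R[i].

Lemma Re_add z w : complex.Re (z + w) = complex.Re z + complex.Re w.
Proof. by case: z w => [? ?] [? ?]. Qed.

Lemma Im_add z w : complex.Im (z + w) = complex.Im z + complex.Im w.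
Proof. by case: z w => [? ?] [? ?]. Qed.

Lemma Re_opp z : complex.Re (- z) = - complex.Re z.
Proof. by case: z. Qed.

Lemma Im_opp z : complex.Im (- z) = - complex.Im z.
Proof. by case: z. Qed.

Lemma Re_mul z w :
  complex.Re (z * w) = complex.Re z * complex.Re w - complex.Im z * complex.Im w.
Proof. by case: z w => [? ?] [? ?]. Qed.

Lemma Im_mul z w :
  complex.Im (z * w) = complex.Re z * complex.Im w + complex.Im z * complex.Re w.
Proof. by case: z w => [? ?] [? ?]. Qed.

Lemma Re_conj z : complex.Re (conjc z) = complex.Re z.
Proof. by case: z. Qed.

Lemma Im_conj z : complex.Im (conjc z) = - complex.Im z.
Proof. by case: z. Qed.

Lemma Re_inv z : complex.Re z^-1 = complex.Re z / sqnorm z.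
Proof. by case: z. Qed.

Lemma Im_inv z : complex.Im z^-1 = - complex.Im z / sqnorm z.
Proof. by case: z => a b; rewrite mulNr. Qed.

Lemma complex_ext z w :
  complex.Re z = complex.Re w -> complex.Im z = complex.Im w -> z = w.
Proof. by case: z w => [? ?] [? ?] /= -> ->. Qed.

Definition reimE := (Re_add, Im_add, Re_opp, Im_opp, Re_mul, Im_mul, Re_conj, Im_conj).

Lemma sqnorm_ge0 z : 0 <= sqnorm z.
Proof. by rewrite addr_ge0 ?sqr_ge0. Qed.

Lemma sqnorm0 : sqnorm (0 : R[i]) = 0.
Proof. by rewrite /sqnorm /= expr0n addr0. Qed.

Lemma sqnorm1 : sqnorm (1 : R[i]) = 1.
Proof. by rewrite /sqnorm /= expr0n addr0 expr1n. Qed.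

Lemma sqnorm_eq0 z : sqnorm z = 0 -> z = 0.
Proof.
move/eqP; rewrite paddr_eq0 ?sqr_ge0// !sqrf_eq0 => /andP[/eqP a /eqP b].
exact: complex_ext.
Qed.

Lemma sqnormM z w : sqnorm (z * w) = sqnorm z * sqnorm w.
Proof. by rewrite /sqnorm !reimE; ring. Qed.

Lemma sqnormN z : sqnorm (- z) = sqnorm z.
Proof. by rewrite /sqnorm !reimE !sqrrN. Qed.

Lemma sqnorm_conj z : sqnorm (conjc z) = sqnorm z.
Proof. by rewrite /sqnorm !reimE sqrrN. Qed.

Lemma sqnormX z n : sqnorm (z ^+ n) = sqnorm z ^+ n.
Proof.
by elim: n => [|n IH]; rewrite ?expr0 ?sqnorm1// !exprS sqnormM IH.
Qed.

Lemma sqnormD_le z w : sqnorm (z + w) <= 2 * sqnorm z + 2 * sqnorm w.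
Proof.
rewrite /sqnorm !reimE.
have := sqr_ge0 (complex.Re z - complex.Re w).
have := sqr_ge0 (complex.Im z - complex.Im w).
nra.
Qed.

Lemma sqnormB z w : sqnorm (z - w) =
  sqnorm z + sqnorm w - 2 * complex.Re (z * conjc w).
Proof. by rewrite /sqnorm !reimE; ring. Qed.

Lemma conjcM z w : conjc (z * w) = conjc z * conjc w.
Proof. by apply: complex_ext; rewrite !reimE; ring. Qed.

Lemma conjcD z w : conjc (z + w) = conjc z + conjc w.
Proof. by apply: complex_ext; rewrite !reimE; ring. Qed.

Lemma mul_conjcE z : z * conjc z = (sqnorm z)%:C%C.
Proof. by apply: complex_ext; rewrite /sqnorm !reimE /=; ring. Qed.

Lemma sqnorm_expi (t : R) : sqnorm (expi t) = 1.
Proof. exact: cos2Dsin2. Qed.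

Lemma Re_sqr_le z : complex.Re z ^+ 2 <= sqnorm z.
Proof. by rewrite lerDl sqr_ge0. Qed.

Lemma Im_sqr_le z : complex.Im z ^+ 2 <= sqnorm z.
Proof. by rewrite lerDr sqr_ge0. Qed.

(* |v - z| >= 1 - |z| >= (1 - |z|^2) / 2 *)
Lemma sqnormB_ge v z : sqnorm v = 1 -> sqnorm z < 1 ->
  (1 - sqnorm z) ^+ 2 / 4 <= sqnorm (v - z).
Proof.
move=> v1 z1; rewrite sqnormB v1.
have := Re_sqr_le (v * conjc z); rewrite sqnormM sqnorm_conj v1 mul1r.
have := sqnorm_ge0 z; move: (sqnorm z) (complex.Re _) z1 => s x s1 s0 xs.
have sq : 0 <= (1 + s - 2 * x) ^+ 2 by rewrite sqr_ge0.
(* Write 2(1 + s) = (1 + s - 2x) + (1 + s + 2x): the right side is (1 + s - 2x)^2 + (1 + s)^2 -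
   4x^2, and x^2 <= s. *)
have h : (1 - s) ^+ 2 <= 2 * (1 + s) * (1 + s - 2 * x) by nra.
have A0 : 0 <= 1 + s - 2 * x.
  rewrite -(@pmulr_rge0 _ (2 * (1 + s))) ?mulr_gt0 ?ltr_wpDr//.
  by apply: le_trans h; rewrite sqr_ge0.
by nra.
Qed.

Lemma sqnormB_gt0 v z : sqnorm v = 1 -> sqnorm z < 1 -> 0 < sqnorm (v - z).
Proof.
move=> v1 z1; apply: lt_le_trans (sqnormB_ge v1 z1).
by rewrite divr_gt0// exprn_gt0// subr_gt0.
Qed.

Lemma sqnorm_mul_lt1 c v : sqnorm c < 1 -> sqnorm v <= 1 -> sqnorm (c * v) < 1.
Proof.
move=> c1 v1; rewrite sqnormM; apply: le_lt_trans c1.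
by rewrite ler_piMr// sqnorm_ge0.
Qed.

Lemma one_sub_neq0 z : sqnorm z < 1 -> 1 - z != 0.
Proof.
move=> z1; apply/eqP => h; have := sqnormB_gt0 sqnorm1 z1.
by rewrite h sqnorm0 ltxx.
Qed.

End complex_facts.

(** * Bounded measurable functions *)

(** The bound holds at every point of [D], not almost everywhere, because the same function is
    integrated against Lebesgue measure and against all the Clark measures. *)
Definition bounded_mfun d (T : measurableType d) (R : realType) (D : set T)
    (g : T -> R) : Prop :=
  measurable_fun D g /\ exists C, forall t, D t -> `|g t| <= C.

Section bounded_mfun_theory.
Context d (T : measurableType d) (R : realType) (D : set T).
Implicit Types g h : T -> R.

Lemma bounded_mfun_cst (c : R) : bounded_mfun D (fun=> c).
Proof. by split; [exact: measurable_cst|exists `|c|]. Qed.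

Lemma bounded_mfunD g h : bounded_mfun D g -> bounded_mfun D h ->
  bounded_mfun D (fun t => g t + h t).
Proof.
move=> [mg [C gC]] [mh [C' hC']]; split; first exact: measurable_funD.
by exists (C + C') => t Dt; rewrite (le_trans (ler_normD _ _))// lerD// ?gC ?hC'.
Qed.

Lemma bounded_mfunM g h : bounded_mfun D g -> bounded_mfun D h ->
  bounded_mfun D (fun t => g t * h t).
Proof.
move=> [mg [C gC]] [mh [C' hC']]; split; first exact: measurable_funM.
by exists (C * C') => t Dt; rewrite normrM ler_pM// ?gC ?hC'.
Qed.

Lemma bounded_mfunZ c g : bounded_mfun D g -> bounded_mfun D (fun t => c * g t).
Proof. by apply: bounded_mfunM; exact: bounded_mfun_cst. Qed.

Lemma bounded_mfunN g : bounded_mfun D g -> bounded_mfun D (fun t => - g t).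
Proof.
move=> /(bounded_mfunZ (-1)); congr bounded_mfun.
by apply/funext => t; rewrite mulN1r.
Qed.

Lemma bounded_mfunB g h : bounded_mfun D g -> bounded_mfun D h ->
  bounded_mfun D (fun t => g t - h t).
Proof. by move=> bg /bounded_mfunN; exact: bounded_mfunD. Qed.

Lemma bounded_mfun_sqr g : bounded_mfun D g -> bounded_mfun D (fun t => g t ^+ 2).
Proof. by move=> bg; under eq_fun do rewrite expr2; exact: bounded_mfunM. Qed.

Hypothesis mD : measurable D.

Lemma measurable_fun_lim (f_ : nat -> T -> R) g :
  (forall n, measurable_fun D (f_ n)) ->
  (forall t, D t -> f_ n t @[n --> \oo] --> g t) -> measurable_fun D g.
Proof. exact: measurable_fun_cvg. Qed.

Lemma ge0_nd_integral_cvg (mu : {measure set T -> \bar R})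
    (f_ : nat -> T -> \bar R) (f : T -> \bar R) :
  (forall n, measurable_fun D (f_ n)) ->
  (forall n t, D t -> (0 <= f_ n t)%E) ->
  (forall t, D t -> {homo f_^~ t : n m / (n <= m)%N >-> (n <= m)%E}) ->
  (forall t, D t -> f_ n t @[n --> \oo] --> f t) ->
  (\int[mu]_(t in D) f_ n t)%E @[n --> \oo] --> (\int[mu]_(t in D) f t)%E.
Proof.
move=> mf f0 nd ff; rewrite (_ : (\int[mu]_(t in D) f t)%E =
    (\int[mu]_(t in D) limn (f_^~ t))%E).
  exact: cvg_monotone_convergence.
by apply: eq_integral => t; rewrite inE => Dt; apply/esym/cvg_lim => //; exact: ff.
Qed.

Lemma bounded_mfun_lim (f_ : nat -> T -> R) g C :
  (forall n, measurable_fun D (f_ n)) ->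
  (forall n t, D t -> `|f_ n t| <= C) ->
  (forall t, D t -> f_ n t @[n --> \oo] --> g t) -> bounded_mfun D g.
Proof.
move=> mf fC fg; split; first exact: measurable_fun_lim mf fg.
exists C => t Dt.
have cn : `|f_ n t| @[n --> \oo] --> `|g t| by apply: cvg_norm; exact: fg.
rewrite -(cvg_lim _ cn)//; apply: limr_le; first by apply/cvg_ex; exists `|g t|.
by apply: nearW => n; exact: fC.
Qed.

Lemma measurable_fun_inv g : measurable_fun D g ->
  (forall t, D t -> g t != 0) -> measurable_fun D (fun t => (g t)^-1).
Proof.
move=> mg g0; apply: (@measurable_comp _ _ _ _ _ _ [set x : R | x != 0]) => //.
- rewrite (_ : [set x : R | x != 0] = ~` [set 0]); last first.
    by apply/seteqP; split => x /eqP.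
  by apply: measurableC; exact: measurable_set1.
- by move=> _ [t Dt <-]; exact: g0.
apply: subspace_continuous_measurable_fun => //.
- rewrite (_ : [set x : R | x != 0] = ~` [set 0]); last first.
    by apply/seteqP; split => x /eqP.
  by apply: measurableC; exact: measurable_set1.
apply: continuous_in_subspaceT => x.
by rewrite inE /= => x0; exact: inv_continuous.
Qed.

Lemma bounded_mfunV g c : 0 < c -> measurable_fun D g ->
  (forall t, D t -> c <= g t) -> bounded_mfun D (fun t => (g t)^-1).
Proof.
move=> c0 mg gc; split.
  apply: measurable_fun_inv => // t Dt.
  by rewrite gt_eqF// (lt_le_trans c0)// gc.
exists c^-1 => t Dt; have gt0 : 0 < g t by rewrite (lt_le_trans c0)// gc.
by rewrite gtr0_norm ?invr_gt0// lef_pV2 ?posrE// gc.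
Qed.

Variable mu : {measure set T -> \bar R}.
Hypothesis muD : (mu D < +oo)%E.

Lemma bounded_mfun_integrable g : bounded_mfun D g ->
  mu.-integrable D (EFin \o g).
Proof.
move=> [mg [C gC]]; apply: measurable_bounded_integrable => //.
exists C; split; first exact: num_real.
by move=> M CM t Dt; exact: le_trans (gC _ Dt) (ltW CM).
Qed.

Lemma Rintegral_le_bound g C : measurable_fun D g ->
  (forall t, D t -> `|g t| <= C) ->
  `|\int[mu]_(t in D) g t| <= C * fine (mu D).
Proof.
move=> mg gC; have bg : bounded_mfun D g by split => //; exists C.
have ig := bounded_mfun_integrable bg.
apply: le_trans (le_normr_Rintegral mD ig) _.
rewrite -Rintegral_cst//; apply: le_Rintegral => //.
- apply: (@bounded_mfun_integrable (fun t => `|g t|)); split.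
    by apply: measurableT_comp.
  by exists C => t Dt; rewrite normr_id gC.
- exact: (@bounded_mfun_integrable (fun=> C) (bounded_mfun_cst C)).
Qed.

Lemma Rintegral_bounded_cvg (f_ : nat -> T -> R) f C :
  (forall n, measurable_fun D (f_ n)) ->
  (forall n t, D t -> `|f_ n t| <= C) ->
  (forall t, D t -> f_ n t @[n --> \oo] --> f t) ->
  \int[mu]_(t in D) f_ n t @[n --> \oo] --> \int[mu]_(t in D) f t.
Proof.
move=> mf_ f_C f_f.
have mf := measurable_fun_lim mf_ f_f.
have [] := @dominated_convergence _ _ _ mu D mD (fun n => EFin \o f_ n)
  (EFin \o f) (cst C%:E).
- by move=> n; exact/measurable_EFinP.
- exact/measurable_EFinP.
- by apply: aeW => t Dt /=; apply/fine_cvgP; split; [exact: nearW|exact: f_f].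
- exact: (@bounded_mfun_integrable (fun=> C) (bounded_mfun_cst C)).
- by apply: aeW => t n Dt; rewrite lee_fin f_C.
move=> intf _; rewrite -[X in _ --> X]fineK; last exact: integrable_fin_num.
by move=> /fine_cvgP[_].
Qed.

End bounded_mfun_theory.

(** * A monotone class theorem for trigonometric functions *)

Section step.
Variable R : realType.
Implicit Types x y : R.

(** 1 - y^n is 1 - y times the sum of n powers of y, each at least y^n. For y < 1 this gives n y^n
    <= 1 / (1 - y), which absorbs the factor [n] in the exponent of [step_poly]. *)
Lemma natmul_expr_le y n : 0 <= y <= 1 -> (1 - y) * (n%:R * y ^+ n) <= 1 - y ^+ n.
Proof.
move=> /andP[y0 y1]; elim: n => [|n IH]; first by rewrite mul0r mulr0 subrr.
rewrite -natr1 exprS; have := ler_wpM2l y0 IH.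
have : 0 <= (1 - y) * (1 - y * y ^+ n).
  rewrite mulr_ge0 ?subr_ge0// -exprS exprn_ile1//.
by move: (n%:R) (y ^+ n) => a b; nra.
Qed.

(* Brosowski and Deutsch's polynomials; the factor [n] in the exponent settles
   the value at the threshold [x = 1 / 2]. *)
Definition step_poly n : {poly R} := (1 - 'X^n ^+ 2) ^+ (n * 4 ^ n).

Lemma step_poly_bound x n : 0 <= x <= 1 -> 0 <= (step_poly n).[x] <= 1.
Proof.
move=> /andP[x0 x1]; rewrite /step_poly !hornerE.
have h0 : 0 <= 1 - (x ^+ n) ^+ 2.
  by rewrite subr_ge0 expr_le1 ?exprn_ge0// exprn_ile1.
by rewrite exprn_ge0//= exprn_ile1// gerBl sqr_ge0.
Qed.

Lemma bernoulli_ge a n : 0 <= a <= 1 -> 1 - n%:R * a <= (1 - a :> R) ^+ n.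
Proof.
move=> /andP[a0 a1]; elim: n => [|n IH]; first by rewrite mul0r subr0.
rewrite -natr1 exprS; have : 0 <= 1 - a by rewrite subr_ge0.
move=> /ler_wpM2l/(_ _ _ IH); apply: le_trans.
have : 0 <= n%:R * a * a by rewrite !mulr_ge0.
by move: (n%:R) => m; nra.
Qed.

(** Since (1 - a)(1 + a) <= 1, the power is at most (1 + a)^(-n), and Bernoulli's inequality bounds
    (1 + a)^n below. *)
Lemma bernoulli_le a n : 0 <= a <= 1 -> (1 - a :> R) ^+ n <= (1 + n%:R * a)^-1.
Proof.
move=> /andP[a0 a1]; have p0 : 0 < 1 + n%:R * a by rewrite ltr_pwDl// mulr_ge0.
rewrite -[leRHS]mul1r ler_pdivlMr//.
have h : 1 + n%:R * a <= (1 + a) ^+ n.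
  elim: n {p0} => [|n IH]; first by rewrite mul0r addr0.
  rewrite -natr1 exprS; have := ler_wpM2l (addr_ge0 ler01 a0) IH.
  apply: le_trans; have : 0 <= n%:R * a * a by rewrite !mulr_ge0.
  by move: (n%:R) => m; nra.
apply: le_trans (ler_wpM2l _ h) _; first by rewrite exprn_ge0// subr_ge0.
rewrite -exprMn exprn_ile1//; nra.
Qed.

(** With N = n 4^n and a = x^(2n) one has N a = n (2x)^(2n), which tends to 0 if 2x < 1 and is at
    least n if 2x >= 1. The two Bernoulli inequalities turn this into the limits 1 and 0 of (1 -
    a)^N. *)
Lemma step_poly_cvg x : 0 <= x <= 1 ->
  (step_poly n).[x] @[n --> \oo] --> (if x < 2^-1 then 1 else 0 : R).
Proof.
move=> /andP[x0 x1].
have E n : (step_poly n).[x] = (1 - (x ^+ n) ^+ 2) ^+ (n * 4 ^ n).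
  by rewrite /step_poly !hornerE.
have x01 n : 0 <= (x ^+ n) ^+ 2 <= 1.
  by rewrite sqr_ge0 expr_le1 ?exprn_ge0// exprn_ile1.
have mE n : (n * 4 ^ n)%:R * (x ^+ n) ^+ 2 = n%:R * (2 * x) ^+ n * (2 * x) ^+ n.
  rewrite natrM natrX -!mulrA; congr (_ * _).
  by rewrite expr2 mulrA -!exprMn; congr (_ ^+ _); ring.
case: ltP => x2.
- have y01 : 0 <= 2 * x < 1 by apply/andP; split; lra.
  have [y0 y1] := andP y01.
  have d0 : 0 < 1 - 2 * x by lra.
  apply: (@squeeze_cvgr _ _ _ _ (fun n => 1 - (1 - 2 * x)^-1 * (2 * x) ^+ n) (cst 1)).
  + apply: nearW => n; have /andP[_ ->] := step_poly_bound n (introT andP (conj x0 x1)).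
    rewrite andbT E; apply: le_trans _ (bernoulli_ge _ (x01 n)).
    rewrite lerD2l lerN2 mE ler_wpM2r ?exprn_ge0//.
    rewrite -[leRHS]mul1r ler_pdivlMr// mulrC.
    apply: le_trans (natmul_expr_le _ _) _; first by rewrite y0 ltW.
    by rewrite gerBl exprn_ge0.
  + rewrite -[X in _ --> X]subr0; apply: cvgB; first exact: cvg_cst.
    rewrite -[X in _ --> X](mulr0 (1 - 2 * x)^-1); apply: cvgM; first exact: cvg_cst.
    by apply: cvg_expr; rewrite ger0_norm.
  + exact: cvg_cst.
- apply: (@squeeze_cvgr _ _ _ _ (fun=> 0 : R) (fun n => n.+1%:R^-1 : R)).
  + apply: nearW => n; have /andP[-> _] := step_poly_bound n (introT andP (conj x0 x1)).
    rewrite E; apply: le_trans (bernoulli_le _ (x01 n)) _.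
    rewrite lef_pV2 ?posrE ?ltr_pwDl ?mulr_ge0 ?exprn_ge0//.
    rewrite mE -nat1r lerD2l -[leLHS]mulr1 -mulrA ler_wpM2l//.
    by rewrite -exprMn exprn_ege1//; nra.
  + exact: cvg_cst.
  + exact: cvg_harmonic.
Qed.

End step.

(** * From cosines to all bounded Borel functions *)

Section monotone_class.
Variable R : realType.
Variable M : (R -> R) -> Prop.
Hypothesis M_bounded : forall f, M f -> exists C : R, forall t, Dom t -> `|f t| <= C.
Hypothesis M_add : forall f g, M f -> M g -> M (fun t => f t + g t).
Hypothesis M_scale : forall c f, M f -> M (fun t => c * f t).
Hypothesis M_lim : forall (f_ : nat -> R -> R) (f : R -> R) (C : R),
  (forall n, M (f_ n)) -> (forall n t, Dom t -> `|f_ n t| <= C) ->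
  (forall t, Dom t -> f_ n t @[n --> \oo] --> f t) -> M f.
Hypothesis M_cos : forall (k : nat) s, M (fun t => cos (k%:R * (t - s))).

(** A constant sequence converges on [Dom] to every function that agrees with it there, so [M_lim]
    makes the class insensitive to values off [Dom]. *)
Lemma M_ext f g : (forall t, Dom t -> f t = g t) -> M f -> M g.
Proof.
move=> fg Mf; have [C fC] := M_bounded Mf.
apply: (@M_lim (fun=> f) g C) => // t Dt; rewrite fg//; exact: cvg_cst.
Qed.

Lemma M_cst c : M (fun=> c).
Proof.
by apply: M_ext (M_scale c (M_cos 0 0)) => t _; rewrite mul0r cos0 mulr1.
Qed.

Lemma M_sum (I : Type) (r : seq I) (F : I -> R -> R) :
  (forall i, M (F i)) -> M (fun t => \sum_(i <- r) F i t).
Proof.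
move=> MF; elim: r => [|i r IH].
  by apply: M_ext (M_cst 0) => t _; rewrite big_nil.
by apply: M_ext (M_add (MF i) IH) => t _; rewrite big_cons.
Qed.

(** [M] is not assumed closed under products, so powers of a cosine are linearized by cos x cos(jx)
    = (cos((j+1)x) + cos((j-1)x)) / 2. The additional factor cos(kx) is what the induction on the
    power needs. *)
Lemma M_cosX_mul n (k : nat) s :
  M (fun t => cos (t - s) ^+ n * cos (k%:R * (t - s))).
Proof.
elim: n k => [|n IH] [|k].
- by apply: M_ext (M_cos 0 s) => t _; rewrite expr0 mul1r.
- by apply: M_ext (M_cos k.+1 s) => t _; rewrite expr0 mul1r.
(* At frequency 0 the product formula would call for frequency -1; one cosine is moved into the
   second factor instead. *)
- apply: M_ext (IH 1) => t _.
  by rewrite !mul0r mul1r cos0 mulr1 exprSr.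
apply: M_ext (M_scale 2^-1 (M_add (IH k.+2) (IH k))) => t _.
have -> : k.+2%:R * (t - s) = k.+1%:R * (t - s) + (t - s).
  by rewrite -!natr1; ring.
have -> : k%:R * (t - s) = k.+1%:R * (t - s) - (t - s).
  by rewrite -!natr1; ring.
by rewrite exprS; move: (t - s) => x; rewrite cosD cosB; field.
Qed.

Lemma M_horner_cos (p : {poly R}) s : M (fun t => p.[cos (t - s)]).
Proof.
have : M (fun t => \sum_(i <- index_enum 'I_(size p))
    p`_i * (cos (t - s) ^+ i * cos (0%:R * (t - s)))).
  by apply: M_sum => i; exact/M_scale/M_cosX_mul.
apply: M_ext => t _; rewrite horner_coef; apply: eq_bigr => i _.
by rewrite mul0r cos0 mulr1.
Qed.



Lemma M_opp1 f : M f -> M (fun t => 1 - f t).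
Proof.
move=> Mf; apply: M_ext (M_add (M_cst 1) (M_scale (-1) Mf)) => t _.
by rewrite mulN1r.
Qed.

Lemma M_indic_arc s c : -1 <= c <= 1 ->
  M (fun t => if cos (t - s) < c then 1 else 0).
Proof.
move=> /andP[c0 c1].
(* The affine map sends the threshold [c] to 1/2; the slope 1/4 keeps its values on [-1, 1] inside
   [0, 1], because |x - c| <= 2. *)
pose p : {poly R} := (2^-1)%:P + 4^-1 *: ('X - c%:P).
have pE x : p.[x] = 2^-1 + 4^-1 * (x - c) by rewrite /p !hornerE.
have p01 t : 0 <= p.[cos (t - s)] <= 1.
  rewrite pE; have := cos_le1 (t - s); have := cos_geN1 (t - s).
  by move: (cos _) => x *; apply/andP; split; lra.
apply: (@M_lim (fun n t => (step_poly R n \Po p).[cos (t - s)]) _ 1).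
- by move=> n; exact: M_horner_cos.
- move=> n t _; rewrite horner_comp.
  by have /andP[? ?] := step_poly_bound n (p01 t); rewrite ger0_norm.
move=> t _; have -> : (cos (t - s) < c) = (p.[cos (t - s)] < 2^-1).
  by rewrite pE; move: (cos _) => x; apply/idP/idP => ?; lra.
apply: cvg_trans (step_poly_cvg (p01 t)).
by under eq_fun do rewrite horner_comp.
Qed.

(** The points of the circle at angular distance at most b/2 from b/2 form the arc [0, b]; the
    cosine inequality describes the complement of this arc. *)
Lemma Dom_arc (b t : R) : 0 <= b < 2 * pi -> Dom t ->
  (cos (t - b / 2) < cos (b / 2)) = (b < t).
Proof.
move=> /andP[b0 b2]; rewrite /Dom /= in_itv /= => /andP[t0 t2].
have [bt|tb] := ltP b t.
- have [xpi|xpi] := leP (t - b / 2) pi.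
    by rewrite ltr_cos ?in_itv /=; [lra|apply/andP; split; lra..].
  (* Beyond pi the angular distance is measured the other way round the circle. *)
  have -> : cos (t - b / 2) = cos (2 * pi - (t - b / 2)).
    by rewrite -[RHS]cosN opprB -[RHS]cosD2pi -[pi *+ 2]mulr_natl subrK.
  by rewrite ltr_cos ?in_itv /=; [lra|apply/andP; split; lra..].
- apply/negbTE; rewrite -leNgt -(cos_norm (t - b / 2)).
  have h : `|t - b / 2| <= b / 2 by rewrite ler_norml; apply/andP; split; lra.
  rewrite leNgt ltr_cos ?in_itv /= -?leNgt//.
    by apply/andP; split; lra.
  by rewrite normr_ge0/=; lra.
Qed.

Lemma M_indic_ray (b : R) : M \1_`]b, +oo[.
Proof.
have E t : \1_`]b, +oo[ t = (if b < t then 1 else 0) :> R.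
  by rewrite indicE mem_setE in_itv /= andbT; case: ifP.
have [b0|b0] := ltP b 0.
  apply: M_ext (M_cst 1) => t; rewrite E /Dom /= in_itv /= => /andP[t0 _].
  by rewrite (lt_le_trans b0 t0).
have [b2|b2] := leP (2 * pi) b.
  apply: M_ext (M_cst 0) => t; rewrite E /Dom /= in_itv /= => /andP[_ t2].
  by rewrite ltNge (le_trans (ltW t2) b2).
have c1 : -1 <= cos (b / 2) <= 1 by rewrite cos_geN1 cos_le1.
apply: M_ext (M_indic_arc (b / 2) c1) => t Dt.
by rewrite E Dom_arc// b0.
Qed.

Lemma sum_indic_trivIset (F : nat -> set R) (t : R) k n : trivIset setT F ->
  F k t -> \sum_(i <- index_iota 0 n) \1_(F i) t = (k < n)%:R :> R.
Proof.
move=> tF Fkt; elim: n => [|n IH]; first by rewrite big_geq.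
rewrite big_nat_recr//= IH; have -> : \1_(F n) t = (n == k)%:R :> R.
  rewrite indicE; have [->|nk] := eqVneq n k; first by rewrite mem_set.
  rewrite memNset// => Fnt; move/eqP: nk; apply; apply: tF => //.
  by exists t.
rewrite [in RHS]ltnS [in RHS]leq_eqVlt [n == k]eq_sym.
by case: ltngtP => _ /=; rewrite ?addr0 ?add0r.
Qed.

(** Dynkin's theorem fits the closure properties of [M]: the rays are stable under intersection and
    generate the Borel sets, complements are 1 - f, and a disjoint union is the limit of partial
    sums bounded by 1. *)
Lemma M_indic (A : set R) : measurable A -> M \1_A.
Proof.
move=> mA; pose P (B : set (measurableTypeR R)) := M (\1_B : R -> R).
have : (@RGenOInfty.G R).-sigma.-measurable A by rewrite -RGenOInfty.measurableE.
apply: (@dynkin_induction _ (measurableTypeR R) (@RGenOInfty.G R) P).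
- exact: RGenOInfty.measurableE.
- move=> _ _ [x ->] [y ->]; exists (Num.max x y).
  apply/seteqP; split => t; rewrite /= !in_itv/= !andbT gt_max.
    by move=> [-> ->].
  by move=> /andP[].
- by apply: M_ext (M_cst 1) => t _; rewrite indicT.
- by move=> _ [b ->]; exact: M_indic_ray.
- move=> B _ /M_opp1; apply: M_ext => t _.
  by rewrite !indicE in_setC; case: (t \in B); rewrite ?subr0 ?subrr.
move=> F _ tF PF.
apply: (@M_lim (fun n t => \sum_(i <- index_iota 0 n) \1_(F i) t) _ 1).
- by move=> n; apply: M_sum => i; exact: PF.
- move=> n t _; have [[k _ Fk]|nF] := pselect ((\bigcup_k F k) t).
    by rewrite (sum_indic_trivIset _ tF Fk); case: ltnP; rewrite ?normr1 ?normr0.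
  rewrite big1 ?normr0// => i _; rewrite indicE memNset// => Ft.
  by apply: nF; exists i.
- move=> t _; rewrite indicE; have [Ft|nF] := pselect ((\bigcup_k F k) t).
    rewrite mem_set//; have [k _ Fk] := Ft.
    apply: cvg_near_cst; exists k.+1 => // n /= kn.
    by rewrite (sum_indic_trivIset _ tF Fk) kn.
  rewrite memNset//; apply: cvg_near_cst; apply: nearW => n.
  rewrite big1// => i _; rewrite indicE memNset// => Ft.
  by apply: nF; exists i.
Qed.

Import HBNNSimple.

Lemma M_nnsfun (g : {nnsfun R >-> R}) : M g.
Proof.
have : M (fun t => \sum_(y <- finmap.enum_fset (fset_set (range g))) y * \1_(g @^-1` [set y]) t).
  apply: M_sum => y; apply: M_scale; apply: M_indic.
  exact: measurable_sfunP.
by apply: M_ext => t _; rewrite fimfunE fsbig_finite.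
Qed.

(** The shift g + C is nonnegative and at most 2C on [Dom], so its increasing approximation by
    simple functions is a bounded limit. *)
Lemma trig_monotone_class g : bounded_mfun Dom g -> M g.
Proof.
have mDom : measurable (Dom : set R) by exact: measurable_itv.
move=> [mg [C gC]]; pose h t := g t + C.
have h0 t : Dom t -> (0 <= (h t)%:E)%E.
  by move=> /gC; rewrite ler_norml lee_fin /h => /andP[? _]; lra.
have mh : measurable_fun Dom h by apply: measurable_funD.
have [g_ [nd_g cvg_g]] := approximation mDom ((measurable_EFinP _ _).2 mh) h0.
have {}cvg_g t : Dom t -> g_ n t @[n --> \oo] --> h t.
  by move=> /cvg_g /fine_cvgP[].
have Mh : M h.
  apply: (@M_lim (fun n => g_ n) h (C + C)) => //; first by move=> n; exact: M_nnsfun.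
  move=> n t Dt; rewrite ger0_norm//.
  have : g_ n t <= h t.
    rewrite -(cvg_lim _ (cvg_g _ Dt))//; apply: nondecreasing_cvgn_le.
      by move=> m k mk; exact/lefP/nd_g.
    by apply/cvg_ex; exists (h t); exact: cvg_g.
  move=> /le_trans; apply; rewrite lerD2r.
  by have := gC _ Dt; rewrite ler_norml => /andP[].
apply: M_ext (M_add Mh (M_cst (- C))) => t _.
by rewrite /h addrK.
Qed.

End monotone_class.

(** * Integration over the circle *)

Section circle_integral.
Variable R : realType.
Implicit Types (f g h : R -> R) (F G : R -> R[i]) (c : R[i]).
Local Notation mu := (@lebesgue_measure R).

Lemma measurable_Dom : measurable (Dom : set R).
Proof. exact: measurable_itv. Qed.
Hint Resolve measurable_Dom : core.

Lemma twopi_gt0 : 0 < 2 * pi :> R.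
Proof. by rewrite mulr_gt0// pi_gt0. Qed.

Lemma lebesgue_Dom : mu Dom = (2 * pi)%:E.
Proof.
by rewrite /Dom lebesgue_measure_itv /= lte_fin twopi_gt0 -EFinB subr0.
Qed.

Lemma lebesgue_Dom_lty : (mu Dom < +oo)%E.
Proof. by rewrite lebesgue_Dom ltry. Qed.

Definition circle_integrable f : Prop := mu.-integrable Dom (EFin \o f).

Lemma circle_integrableD f g : circle_integrable f -> circle_integrable g ->
  circle_integrable (fun t => f t + g t).
Proof. exact: integrableD. Qed.

Lemma circle_integrableZ (k : R) f : circle_integrable f ->
  circle_integrable (fun t => k * f t).
Proof. exact: integrableZl. Qed.

Lemma circle_integrableN f : circle_integrable f ->
  circle_integrable (fun t => - f t).
Proof.
by move=> /(circle_integrableZ (-1)); under eq_fun do rewrite mulN1r.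
Qed.

Lemma circle_integrableB f g : circle_integrable f -> circle_integrable g ->
  circle_integrable (fun t => f t - g t).
Proof. by move=> If /circle_integrableN; exact: circle_integrableD. Qed.

Lemma bounded_circle_integrable f : bounded_mfun Dom f -> circle_integrable f.
Proof.
exact: (bounded_mfun_integrable (measurable_Dom : @measurable _ (measurableTypeR R) Dom)
  lebesgue_Dom_lty).
Qed.

Lemma circle_integrableM f g : bounded_mfun Dom f -> circle_integrable g ->
  circle_integrable (fun t => f t * g t).
Proof.
move=> [mf [C fC]] ig.
have bf : [bounded f t | t in (Dom : set (measurableTypeR R))].
  exists C; split; first exact: num_real.
  by move=> M CM t Dt; exact: le_trans (fC _ Dt) (ltW CM).
exact: (integrableMr (measurable_Dom : @measurable _ (measurableTypeR R) Dom)
  mf bf ig).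
Qed.

Lemma circle_integrable_le f g : measurable_fun Dom f ->
  (forall t, Dom t -> `|f t| <= g t) -> circle_integrable g -> circle_integrable f.
Proof.
move=> mf fg; apply: le_integrable => //; first exact/measurable_EFinP.
by move=> t Dt; rewrite lee_fin (le_trans (fg _ Dt))// ler_norm.
Qed.

Lemma mRintD f g : circle_integrable f -> circle_integrable g ->
  mRint (fun t => f t + g t) = mRint f + mRint g.
Proof. by move=> If Ig; rewrite /mRint RintegralD// mulrDr. Qed.

Lemma mRintB f g : circle_integrable f -> circle_integrable g ->
  mRint (fun t => f t - g t) = mRint f - mRint g.
Proof. by move=> If Ig; rewrite /mRint RintegralB// mulrBr. Qed.

Lemma mRintZ (k : R) f : circle_integrable f ->
  mRint (fun t => k * f t) = k * mRint f.
Proof. by move=> If; rewrite /mRint RintegralZl// mulrCA. Qed.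

Lemma mRintN f : circle_integrable f -> mRint (fun t => - f t) = - mRint f.
Proof.
by move=> If; under eq_fun do rewrite -mulN1r; rewrite mRintZ// mulN1r.
Qed.

Lemma mRint_cst (k : R) : mRint (fun=> k) = k.
Proof.
rewrite /mRint Rintegral_cst// (_ : fine _ = 2 * pi).
  by rewrite mulrCA mulVf ?mulr1// gt_eqF// twopi_gt0.
exact: (congr1 fine lebesgue_Dom).
Qed.

Lemma eq_mRint f g : (forall t, Dom t -> f t = g t) -> mRint f = mRint g.
Proof.
by move=> fg; rewrite /mRint; congr (_ * _); apply: eq_Rintegral => t; rewrite inE => /fg.
Qed.

Lemma ae_eq_mRint f g : measurable_fun Dom f -> measurable_fun Dom g ->
  ae_T (fun t => f t = g t) -> mRint f = mRint g.
Proof.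
move=> mf mg fg; rewrite /mRint /Rintegral; congr (_ * fine _).
apply: ae_eq_integral => //; [exact/measurable_EFinP|exact/measurable_EFinP|].
move: fg; apply: negligibleS => t /= /not_implyP[Dt nfg]; split => // fg.
by apply: nfg; rewrite fg.
Qed.

Lemma mRint_ge0 f : (forall t, Dom t -> 0 <= f t) -> 0 <= mRint f.
Proof.
move=> f0; rewrite mulr_ge0 ?invr_ge0 ?(ltW twopi_gt0)//; exact: Rintegral_ge0.
Qed.

Lemma le_mRint f g : circle_integrable f -> circle_integrable g ->
  (forall t, Dom t -> f t <= g t) -> mRint f <= mRint g.
Proof.
move=> If Ig fg; rewrite ler_wpM2l ?invr_ge0 ?(ltW twopi_gt0)//.
exact: le_Rintegral.
Qed.

Lemma mRint_cvg (f_ : nat -> R -> R) f (C : R) :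
  (forall n, measurable_fun Dom (f_ n)) ->
  (forall n t, Dom t -> `|f_ n t| <= C) ->
  (forall t, Dom t -> f_ n t @[n --> \oo] --> f t) ->
  mRint (f_ n) @[n --> \oo] --> mRint f.
Proof.
move=> mf fC ff; apply: cvgM; first exact: cvg_cst.
exact: (Rintegral_bounded_cvg
  (measurable_Dom : @measurable _ (measurableTypeR R) Dom) lebesgue_Dom_lty mf fC ff).
Qed.

(** * Complex-valued integrands *)

Definition circle_Cintegrable F : Prop :=
  circle_integrable (fun t => complex.Re (F t)) /\
  circle_integrable (fun t => complex.Im (F t)).

Definition bounded_Cmfun F : Prop :=
  bounded_mfun Dom (fun t => complex.Re (F t)) /\
  bounded_mfun Dom (fun t => complex.Im (F t)).

Lemma bounded_Cintegrable F : bounded_Cmfun F -> circle_Cintegrable F.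
Proof. by move=> [? ?]; split; exact: bounded_circle_integrable. Qed.

Lemma bounded_Cmfun_cst c : bounded_Cmfun (fun=> c).
Proof. by split; exact: bounded_mfun_cst. Qed.

Lemma bounded_CmfunD F G : bounded_Cmfun F -> bounded_Cmfun G ->
  bounded_Cmfun (fun t => F t + G t).
Proof.
move=> [? ?] [? ?].
by split; under eq_fun do rewrite reimE; exact: bounded_mfunD.
Qed.

Lemma bounded_CmfunM F G : bounded_Cmfun F -> bounded_Cmfun G ->
  bounded_Cmfun (fun t => F t * G t).
Proof.
move=> [? ?] [? ?]; split; under eq_fun do rewrite reimE.
  by apply: bounded_mfunB; exact: bounded_mfunM.
by apply: bounded_mfunD; exact: bounded_mfunM.
Qed.

Lemma bounded_CmfunN F : bounded_Cmfun F -> bounded_Cmfun (fun t => - F t).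
Proof.
by move=> [? ?]; split; under eq_fun do rewrite reimE; exact: bounded_mfunN.
Qed.

Lemma bounded_CmfunB F G : bounded_Cmfun F -> bounded_Cmfun G ->
  bounded_Cmfun (fun t => F t - G t).
Proof. by move=> bF /bounded_CmfunN; exact: bounded_CmfunD. Qed.

Lemma bounded_Cmfun_conj F : bounded_Cmfun F -> bounded_Cmfun (fun t => conjc (F t)).
Proof.
by move=> [? ?]; split; under eq_fun do rewrite reimE; [|exact: bounded_mfunN].
Qed.

Lemma bounded_CmfunX F n : bounded_Cmfun F -> bounded_Cmfun (fun t => F t ^+ n).
Proof.
move=> bF; elim: n => [|n IH]; first exact: bounded_Cmfun_cst.
by under eq_fun do rewrite exprS; exact: bounded_CmfunM.
Qed.

Lemma bounded_Cmfun_real f : bounded_mfun Dom f ->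
  bounded_Cmfun (fun t => (f t)%:C%C).
Proof. by split => //; exact: bounded_mfun_cst. Qed.

Lemma bounded_mfun_sqnorm F : bounded_Cmfun F ->
  bounded_mfun Dom (fun t => sqnorm (F t)).
Proof.
by move=> [? ?]; apply: bounded_mfunD; exact: bounded_mfun_sqr.
Qed.

Lemma bounded_CmfunV F (k : R) : 0 < k -> bounded_Cmfun F ->
  (forall t, Dom t -> k <= sqnorm (F t)) -> bounded_Cmfun (fun t => (F t)^-1).
Proof.
move=> k0 bF kF.
have bV := bounded_mfunV k0 (bounded_mfun_sqnorm bF).1 kF.
case: bF => bR bI; split.
  by under eq_fun do rewrite Re_inv; exact: bounded_mfunM.
by under eq_fun do rewrite Im_inv; apply: bounded_mfunM => //; exact: bounded_mfunN.
Qed.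

Lemma bounded_Cmfun_expi : bounded_Cmfun (@expi R).
Proof.
split; split.
- by apply: measurable_funS (measurableT) _ (continuous_measurable_fun _) => //;
    exact: continuous_cos.
- by exists 1 => t _; exact: cos_max.
- by apply: measurable_funS (measurableT) _ (continuous_measurable_fun _) => //;
    exact: continuous_sin.
- by exists 1 => t _; exact: sin_max.
Qed.

Lemma bounded_Cmfun_poly (p : {poly R[i]}) : bounded_Cmfun (fun t => p.[expi t]).
Proof.
elim/poly_ind: p => [|p c IH].
  by under eq_fun do rewrite horner0; exact: bounded_Cmfun_cst.
under eq_fun do rewrite hornerMXaddC.
apply: bounded_CmfunD; last exact: bounded_Cmfun_cst.
by apply: bounded_CmfunM => //; exact: bounded_Cmfun_expi.
Qed.

Lemma circle_CintegrableM F G : bounded_Cmfun F -> circle_Cintegrable G ->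
  circle_Cintegrable (fun t => F t * G t).
Proof.
move=> [? ?] [? ?]; split; under eq_fun do rewrite reimE.
  by apply: circle_integrableB; exact: circle_integrableM.
by apply: circle_integrableD; exact: circle_integrableM.
Qed.

Lemma mCintD F G : circle_Cintegrable F -> circle_Cintegrable G ->
  mCint (fun t => F t + G t) = mCint F + mCint G.
Proof.
move=> [? ?] [? ?]; apply: complex_ext; rewrite !reimE /= -mRintD//.
  by apply: eq_mRint => t _; rewrite reimE.
by apply: eq_mRint => t _; rewrite reimE.
Qed.

Lemma mCintZ c F : circle_Cintegrable F -> mCint (fun t => c * F t) = c * mCint F.
Proof.
move=> [? ?]; apply: complex_ext; rewrite !reimE /= -!mRintZ//.
  rewrite -mRintB; [|exact: circle_integrableZ..].
  by apply: eq_mRint => t _; rewrite reimE.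
rewrite -mRintD; [|exact: circle_integrableZ..].
by apply: eq_mRint => t _; rewrite reimE.
Qed.

Lemma mCintB F G : circle_Cintegrable F -> circle_Cintegrable G ->
  mCint (fun t => F t - G t) = mCint F - mCint G.
Proof.
move=> [? ?] [? ?]; apply: complex_ext; rewrite !reimE /= -mRintB//.
  by apply: eq_mRint => t _; rewrite !reimE.
by apply: eq_mRint => t _; rewrite !reimE.
Qed.

Lemma mCint_cst c : mCint (fun=> c) = c.
Proof. by apply: complex_ext; exact: mRint_cst. Qed.

Lemma mCint_conj F : circle_Cintegrable F ->
  mCint (fun t => conjc (F t)) = conjc (mCint F).
Proof.
move=> [? ?]; apply: complex_ext; rewrite !reimE /=.
  by apply: eq_mRint => t _; rewrite reimE.
by rewrite -mRintN//; apply: eq_mRint => t _; rewrite reimE.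
Qed.

Lemma eq_mCint F G : (forall t, Dom t -> F t = G t) -> mCint F = mCint G.
Proof.
by move=> FG; apply: complex_ext; apply: eq_mRint => t Dt; rewrite FG.
Qed.

Lemma ae_eq_mCint F G : cmeasurable F -> cmeasurable G ->
  ae_T (fun t => F t = G t) -> mCint F = mCint G.
Proof.
move=> [? ?] [? ?] FG; apply: complex_ext; apply: ae_eq_mRint => //;
  by move: FG; apply: negligibleS => t [Dt nFG]; split => // FGt; apply: nFG;
     rewrite /= FGt.
Qed.

(** For the probability measure m, the variance int (f - m)^2 = int f^2 - m^2 is nonnegative, where
    m on both sides of the minus sign is the mean of f. *)
Lemma sqr_mRint_le f : bounded_mfun Dom f -> mRint f ^+ 2 <= mRint (fun t => f t ^+ 2).
Proof.
move=> bf; set m := mRint f.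
have If := bounded_circle_integrable bf.
have If2 := bounded_circle_integrable (bounded_mfun_sqr bf).
have : 0 <= mRint (fun t => (f t ^+ 2 - (2 * m) * f t) + m ^+ 2).
  apply: mRint_ge0 => t _; apply: le_trans (sqr_ge0 (f t - m)) _.
  by rewrite sqrrB le_eqVlt; apply/orP; left; apply/eqP; ring.
have Im := circle_integrableZ (2 * m) If.
rewrite mRintD; [|exact: circle_integrableB|]; last first.
  exact/bounded_circle_integrable/bounded_mfun_cst.
by rewrite mRintB// mRintZ// mRint_cst -/m; lra.
Qed.

Lemma sqnorm_mCint_le F : bounded_Cmfun F ->
  sqnorm (mCint F) <= mRint (fun t => sqnorm (F t)).
Proof.
move=> [bR bI]; rewrite /sqnorm mRintD; last 2 first.
- exact/bounded_circle_integrable/bounded_mfun_sqr.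
- exact/bounded_circle_integrable/bounded_mfun_sqr.
by apply: lerD; exact: sqr_mRint_le.
Qed.

End circle_integral.
#[global] Hint Extern 0 (measurable _) => solve [exact: measurable_Dom] : core.

(** * Fourier and Poisson integrals *)

Section fourier.
Variable R : realType.
Implicit Types (F G W u : R -> R[i]) (c v w : R[i]).

(** Fundamental theorem of calculus over one period of an antiderivative. *)
Lemma mRint_derive (f F : R -> R) : (forall x : R, is_derive x 1 F (f x)) ->
  continuous f -> F (2 * pi) = F 0 -> mRint f = 0.
Proof.
move=> dF cf F2.
have cF : continuous F.
  by move=> x; apply: differentiable_continuous; apply/derivable1_diffP; exact: ex_derive.
rewrite /mRint /Rintegral /Dom integral_itv_bndo_bndc; last first.
  apply/measurable_EFinP; apply: measurable_funS (continuous_measurable_fun cf) => //.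
rewrite (continuous_FTC2 (F := F)).
- by rewrite F2 subee//= mulr0.
- exact: twopi_gt0.
- exact: continuous_subspaceT.
- split.
  + by move=> x _; exact: ex_derive.
  + by apply: cvg_at_right_filter; exact: cF.
  + by apply: cvg_at_left_filter; exact: cF.
- by move=> x _; rewrite derive1E; exact: derive_val.
Qed.

Lemma expiX (t : R) n : expi t ^+ n = expi (n%:R * t).
Proof.
elim: n => [|n IH]; first by rewrite expr0 mul0r /expi cos0 sin0.
rewrite exprS IH -nat1r mulrDl mul1r.
apply: complex_ext; rewrite !reimE /expi /=; first by rewrite cosD.
by rewrite sinD addrC.
Qed.

Lemma cos_nat_twopi n : cos (n%:R * (2 * pi)) = 1 :> R.
Proof.
elim: n => [|n IH]; first by rewrite mul0r cos0.
by rewrite -natr1 mulrDl mul1r [2 * _]mulr_natl cosD2pi -[pi *+ 2]mulr_natl.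
Qed.

Lemma sin_nat_twopi n : sin (n%:R * (2 * pi)) = 0 :> R.
Proof.
elim: n => [|n IH]; first by rewrite mul0r sin0.
by rewrite -natr1 mulrDl mul1r [2 * _]mulr_natl sinD2pi -[pi *+ 2]mulr_natl.
Qed.

Lemma mCint_expiX n : (0 < n)%N -> mCint (fun t => expi t ^+ n) = 0 :> R[i].
Proof.
move=> n0; have nn : n%:R != 0 :> R by rewrite pnatr_eq0 -lt0n.
apply: complex_ext => /=.
- rewrite (eq_mRint (g := fun t => cos (n%:R * t))); last by move=> t _; rewrite expiX.
  apply: (@mRint_derive _ (fun t => n%:R^-1 * sin (n%:R * t))).
  + move=> x; apply: is_derive_eq.
    by rewrite /GRing.scale /=; field.
  + by move=> x; apply: continuous_comp; [exact: mulrl_continuous|exact: continuous_cos].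
  + by rewrite sin_nat_twopi !mulr0 sin0 mulr0.
- rewrite (eq_mRint (g := fun t => sin (n%:R * t))); last by move=> t _; rewrite expiX.
  apply: (@mRint_derive _ (fun t => - n%:R^-1 * cos (n%:R * t))).
  + move=> x; apply: is_derive_eq.
    by rewrite /GRing.scale /=; field.
  + by move=> x; apply: continuous_comp; [exact: mulrl_continuous|exact: continuous_sin].
  + by rewrite cos_nat_twopi mulr0 cos0.
Qed.

Lemma le0_geometric (x s K : R) : 0 <= s < 1 ->
  (forall n, x <= s ^+ n * K) -> x <= 0.
Proof.
move=> /andP[s0 s1] h.
have c : (s ^+ n * K) @[n --> \oo] --> (0 : R).
  rewrite -(mul0r K); apply: cvgM; last exact: cvg_cst.
  by apply: cvg_expr; rewrite ger0_norm.
by rewrite -(cvg_lim _ c)//; apply: limr_ge; [apply/cvg_ex; exists 0|exact: nearW].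
Qed.

(** The lower bound depends on [c] alone, which makes 1 / (1 - c u) bounded over the whole
    circle. *)
Lemma sqnorm_one_sub_ge c v : sqnorm c < 1 -> sqnorm v <= 1 ->
  (1 - sqnorm c) ^+ 2 / 4 <= sqnorm (1 - c * v).
Proof.
move=> c1 v1; have cv1 := sqnorm_mul_lt1 c1 v1.
apply: le_trans (sqnormB_ge (@sqnorm1 R) cv1).
have : sqnorm (c * v) <= sqnorm c by rewrite sqnormM ler_piMr// sqnorm_ge0.
by have := sqnorm_ge0 (c * v); nra.
Qed.

Lemma bounded_Cmfun_resolvent u c : bounded_Cmfun u ->
  (forall t, Dom t -> sqnorm (u t) <= 1) -> sqnorm c < 1 ->
  bounded_Cmfun (fun t => (1 - c * u t)^-1).
Proof.
move=> bu u1 c1; apply: (@bounded_CmfunV _ _ ((1 - sqnorm c) ^+ 2 / 4)).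
- by rewrite divr_gt0// exprn_gt0// subr_gt0.
- apply: bounded_CmfunB; first exact: bounded_Cmfun_cst.
  by apply: bounded_CmfunM => //; exact: bounded_Cmfun_cst.
- by move=> t Dt; apply: sqnorm_one_sub_ge => //; exact: u1.
Qed.

(* Both sides have the geometric expansion [sum_n c^n (A v^n)]. *)
Lemma mCint_resolvent W u c v A : bounded_Cmfun W -> bounded_Cmfun u ->
  (forall t, Dom t -> sqnorm (u t) <= 1) -> sqnorm c < 1 -> sqnorm v <= 1 ->
  (forall n, mCint (fun t => W t * u t ^+ n) = A * v ^+ n) ->
  mCint (fun t => W t / (1 - c * u t)) = A / (1 - c * v).
Proof.
move=> bW bu u1 c1 v1 WuA.
have bV := bounded_Cmfun_resolvent bu u1 c1.
pose F n t := u t ^+ n * (W t / (1 - c * u t)).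
have bF n : bounded_Cmfun (F n).
  by do 2?apply: bounded_CmfunM => //; exact: bounded_CmfunX.
(* One step of the expansion: 1 / (1 - c u) = 1 + c u / (1 - c u). *)
have XS n : mCint (F n) = A * v ^+ n + c * mCint (F n.+1).
  transitivity (mCint (fun t => W t * u t ^+ n + c * F n.+1 t)).
    apply: eq_mCint => t Dt; rewrite /F exprS; field.
    by apply: one_sub_neq0; apply: sqnorm_mul_lt1 => //; exact: u1.
  rewrite mCintD ?mCintZ ?WuA//; apply: bounded_Cintegrable => //.
  - by apply: bounded_CmfunM => //; exact: bounded_CmfunX.
  - by apply: bounded_CmfunM => //; exact: bounded_Cmfun_cst.
(* [Y n] is the defect of the claim with u^n inserted, cleared of the denominator 1 - c v. From Y 0
   = c^n Y n, with [Y] bounded and |c| < 1, it follows that Y 0 = 0, so no series has to be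
   summed. *)
pose Y n := mCint (F n) * (1 - c * v) - A * v ^+ n.
have YS n : Y n = c * Y n.+1 by rewrite /Y XS exprS; ring.
have YX n : Y 0 = c ^+ n * Y n.
  by elim: n => [|n IH]; rewrite ?mul1r// IH YS exprSr; ring.
have [C hC] := (bounded_mfun_sqnorm (bF 0)).2.
have Xle n : sqnorm (mCint (F n)) <= C.
  apply: le_trans (sqnorm_mCint_le (bF n)) _; rewrite -(mRint_cst C); apply: le_mRint.
  - exact/bounded_circle_integrable/bounded_mfun_sqnorm.
  - exact/bounded_circle_integrable/bounded_mfun_cst.
  move=> t Dt; apply: le_trans (hC _ Dt); rewrite ger0_norm ?sqnorm_ge0//.
  rewrite /F !sqnormM !sqnormX expr0 mul1r ler_piMl//.
    by rewrite -sqnormM sqnorm_ge0.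
  by rewrite exprn_ile1 ?sqnorm_ge0 ?u1.
have Yle n : sqnorm (Y n) <= 2 * (C * sqnorm (1 - c * v)) + 2 * sqnorm A.
  apply: le_trans (sqnormD_le _ _) _; rewrite sqnormN !sqnormM sqnormX.
  apply: lerD; rewrite ler_wpM2l//; first by rewrite ler_wpM2r ?sqnorm_ge0.
  by rewrite ler_piMr ?sqnorm_ge0// exprn_ile1 ?sqnorm_ge0.
have Y0 : Y 0 = 0.
  apply: sqnorm_eq0; apply/eqP; rewrite eq_le sqnorm_ge0 andbT.
  apply: (@le0_geometric _ (sqnorm c)); first by rewrite sqnorm_ge0.
  by move=> n; rewrite (YX n) sqnormM sqnormX ler_wpM2l// exprn_ge0// sqnorm_ge0.
have cv0 : 1 - c * v != 0 by exact/one_sub_neq0/sqnorm_mul_lt1.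
apply: (mulIf cv0); rewrite divfK//.
move/eqP: Y0; rewrite /Y expr0 mulr1 subr_eq0 => /eqP <-; congr (_ * _).
by apply: eq_mCint => t _; rewrite /F expr0 mul1r.
Qed.

(** Only the Fourier condition of [H2]; together with [bounded_Cmfun] it describes bounded analytic
    functions by their boundary values. *)
Definition analytic F : Prop :=
  forall n, (0 < n)%N -> mCint (fun t => F t * expi t ^+ n) = 0.

Lemma bounded_CmfunM_expiX F n : bounded_Cmfun F ->
  bounded_Cmfun (fun t => F t * expi t ^+ n).
Proof.
by move=> bF; apply: bounded_CmfunM => //; apply: bounded_CmfunX;
  exact: bounded_Cmfun_expi.
Qed.

Lemma bounded_CmfunM_poly F p : bounded_Cmfun F ->
  bounded_Cmfun (fun t => F t * p.[expi t]).
Proof.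
by move=> bF; apply: bounded_CmfunM => //; exact: bounded_Cmfun_poly.
Qed.

Lemma analytic_cst c : analytic (fun=> c).
Proof.
move=> n n0; rewrite mCintZ ?mCint_expiX ?mulr0//.
exact/bounded_Cintegrable/bounded_CmfunX/bounded_Cmfun_expi.
Qed.

Lemma analyticM_poly F p : bounded_Cmfun F -> analytic F ->
  analytic (fun t => F t * p.[expi t]).
Proof.
move=> bF aF; elim/poly_ind: p => [|p c IH] n n0.
  rewrite -[RHS](mCint_cst 0); apply: eq_mCint => t _.
  by rewrite horner0 mulr0 mul0r.
transitivity (mCint (fun t => F t * p.[expi t] * expi t ^+ n.+1 +
                              c * (F t * expi t ^+ n))).
  by apply: eq_mCint => t _; rewrite hornerMXaddC exprS; ring.
have bn := bounded_CmfunM_expiX n bF.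
rewrite mCintD ?mCintZ ?IH ?aF ?mulr0 ?addr0//; apply: bounded_Cintegrable => //.
- by apply: bounded_CmfunM_expiX; exact: bounded_CmfunM_poly.
- by apply: bounded_CmfunM => //; exact: bounded_Cmfun_cst.
Qed.

(** On the circle |v - w| = |1 - conj(w) v|. Writing the Poisson kernel through the real part of a
    Cauchy kernel reduces its integrals to [mCint_resolvent]. *)
Lemma poissonE v w : sqnorm v = 1 -> sqnorm w < 1 ->
  (1 - sqnorm w) / sqnorm (v - w) = 2 * complex.Re (1 - conjc w * v)^-1 - 1.
Proof.
move=> v1 w1; have N0 := sqnormB_gt0 v1 w1.
have -> : sqnorm (v - w) = sqnorm (1 - conjc w * v).
  by rewrite !sqnormB sqnorm1 sqnormM sqnorm_conj v1 mulr1 addrC /= !reimE /=; ring.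
rewrite Re_inv; set N := sqnorm (1 - _).
have NE : N = 1 + sqnorm w - 2 * complex.Re (conjc w * v).
  rewrite /N sqnormB sqnorm1 sqnormM sqnorm_conj v1 mulr1 !reimE /=; ring.
have : N != 0.
  by rewrite NE; apply: lt0r_neq0; apply: lt_le_trans N0 _;
    rewrite sqnormB v1 !reimE; lra.
move=> nN; apply: (mulIf nN); rewrite divfK// mulrBl mul1r -mulrA divfK//.
by rewrite {1}NE !reimE /=; lra.
Qed.

Lemma bounded_poisson w : sqnorm w < 1 -> bounded_mfun Dom (poisson w).
Proof.
move=> w1; apply: bounded_mfunZ.
apply: (@bounded_mfunV _ _ _ _ _ ((1 - sqnorm w) ^+ 2 / 4)).
- by rewrite divr_gt0// exprn_gt0// subr_gt0.
- apply: (bounded_mfun_sqnorm _).1; apply: bounded_CmfunB.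
    exact: bounded_Cmfun_expi.
  exact: bounded_Cmfun_cst.
- by move=> t _; apply: sqnormB_ge => //; exact: sqnorm_expi.
Qed.

Lemma poisson_gt0 w t : sqnorm w < 1 -> 0 < poisson w t.
Proof.
by move=> w1; rewrite divr_gt0 ?subr_gt0// sqnormB_gt0// sqnorm_expi.
Qed.

Lemma mRint_poisson w : sqnorm w < 1 -> mRint (poisson w) = 1.
Proof.
move=> w1; have bV : bounded_Cmfun (fun t => (1 - conjc w * expi t)^-1).
  apply: bounded_Cmfun_resolvent; rewrite ?sqnorm_conj//.
    exact: bounded_Cmfun_expi.
  by move=> t _; rewrite sqnorm_expi.
(* The means of xi^n vanish for n > 0, so they are the powers of v = 0; the convention 0^0 = 1
   covers n = 0. *)
have ER : mCint (fun t => 1 / (1 - conjc w * expi t)) = 1 / (1 - conjc w * 0).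
  apply: mCint_resolvent; rewrite ?sqnorm_conj ?sqnorm0//.
  - exact: bounded_Cmfun_cst.
  - exact: bounded_Cmfun_expi.
  - by move=> t _; rewrite sqnorm_expi.
  case=> [|n]; first by under [X in mCint X]eq_fun do rewrite expr0; rewrite mCint_cst expr0.
  by rewrite analytic_cst// expr0n mulr0.
rewrite (eq_mRint (g := fun t => 2 * complex.Re (1 - conjc w * expi t)^-1 - 1)); last first.
  by move=> t _; rewrite /poisson poissonE// sqnorm_expi.
rewrite mRintB ?mRintZ ?mRint_cst.
- have -> : mRint (fun t => complex.Re (1 - conjc w * expi t)^-1) = 1.
    transitivity (complex.Re (mCint (fun t => 1 / (1 - conjc w * expi t)))).
      by apply: eq_mRint => t _; rewrite div1r.
    by rewrite ER mulr0 subr0 divr1.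
  by lra.
- exact/bounded_circle_integrable/bV.1.
- exact/bounded_circle_integrable/bounded_mfunZ/bV.1.
- exact/bounded_circle_integrable/bounded_mfun_cst.
Qed.

(** * Poisson integrals of boundary functions *)

Lemma bounded_CmfunM_poisson w F : sqnorm w < 1 -> bounded_Cmfun F ->
  bounded_Cmfun (fun t => (poisson w t)%:C%C * F t).
Proof.
by move=> w1; apply: bounded_CmfunM; exact/bounded_Cmfun_real/bounded_poisson.
Qed.

Lemma ext_cst w c : sqnorm w < 1 -> ext (fun=> c) w = c.
Proof.
move=> w1; rewrite /ext; under [X in mCint X]eq_fun do rewrite mulrC.
rewrite mCintZ; last first.
  exact/bounded_Cintegrable/bounded_Cmfun_real/bounded_poisson.
rewrite -[RHS]mulr1; congr (_ * _); apply: complex_ext => /=.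
  exact: mRint_poisson.
exact: mRint_cst.
Qed.

Lemma extD F G w : sqnorm w < 1 -> bounded_Cmfun F -> bounded_Cmfun G ->
  ext (fun t => F t + G t) w = ext F w + ext G w.
Proof.
move=> w1 bF bG; rewrite /ext; under [X in mCint X]eq_fun do rewrite mulrDr.
by rewrite mCintD//; exact/bounded_Cintegrable/bounded_CmfunM_poisson.
Qed.

Lemma extZ c F w : sqnorm w < 1 -> bounded_Cmfun F ->
  ext (fun t => c * F t) w = c * ext F w.
Proof.
move=> w1 bF; rewrite /ext; under [X in mCint X]eq_fun do rewrite mulrCA.
by rewrite mCintZ//; exact/bounded_Cintegrable/bounded_CmfunM_poisson.
Qed.

(* [(xi - w) P_w(xi) = (1 - |w|^2) xi / (1 - conj(w) xi)] has only positive
   frequencies. *)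
Lemma ext_mulX F w : sqnorm w < 1 -> bounded_Cmfun F -> analytic F ->
  ext (fun t => F t * expi t) w = w * ext F w.
Proof.
move=> w1 bF aF.
have bFX : bounded_Cmfun (fun t => F t * expi t).
  by apply: bounded_CmfunM => //; exact: bounded_Cmfun_expi.
have bV : bounded_Cmfun (fun t => (1 - conjc w * expi t)^-1).
  apply: bounded_Cmfun_resolvent; rewrite ?sqnorm_conj//.
    exact: bounded_Cmfun_expi.
  by move=> t _; rewrite sqnorm_expi.
apply/eqP; rewrite -subr_eq0 -extZ// /ext -mCintB; last 2 first.
- exact/bounded_Cintegrable/bounded_CmfunM_poisson.
- apply/bounded_Cintegrable/bounded_CmfunM_poisson => //.
  by apply: bounded_CmfunM => //; exact: bounded_Cmfun_cst.
transitivity (mCint (fun t => (1 - sqnorm w)%:C%C *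
  (F t * expi t / (1 - conjc w * expi t))) == 0).
  congr (_ == _); apply: eq_mCint => t _.
  have nz : 1 - conjc w * expi t != 0.
    by apply/one_sub_neq0/sqnorm_mul_lt1; rewrite ?sqnorm_conj ?sqnorm_expi.
  have sn : (sqnorm (expi t - w))%:C%C != 0.
    rewrite eq_complex /= eqxx andbT gt_eqF// sqnormB_gt0//; exact: sqnorm_expi.
  have -> : (poisson w t)%:C%C = (1 - sqnorm w)%:C%C / (sqnorm (expi t - w))%:C%C.
    by rewrite /poisson rmorphM fmorphV.
  have key : (sqnorm (expi t - w))%:C%C * expi t =
      (expi t - w) * (1 - conjc w * expi t).
    rewrite -mul_conjcE conjcD.
    have -> : conjc (- w) = - conjc w by apply: complex_ext; rewrite !reimE.
    have : expi t * conjc (expi t) = 1 by rewrite mul_conjcE sqnorm_expi.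
    move: (conjc (expi t)) => cx h.
    by rewrite -[in RHS]h; ring.
  have key2 : (expi t - w) / (sqnorm (expi t - w))%:C%C =
      expi t / (1 - conjc w * expi t).
    by apply/eqP; rewrite eqr_div// -key mulrC.
  transitivity ((1 - sqnorm w)%:C%C * F t *
      ((expi t - w) / (sqnorm (expi t - w))%:C%C)); first by ring.
  by rewrite key2; ring.
apply/eqP; rewrite mCintZ; last first.
  by apply/bounded_Cintegrable/bounded_CmfunM.
rewrite (@mCint_resolvent _ _ _ 0 0) ?mul0r ?mulr0 ?sqnorm_conj ?sqnorm0//.
- exact: bounded_Cmfun_expi.
- by move=> t _; rewrite sqnorm_expi.
(* The factor xi raises the exponent to n + 1, so the Fourier condition on [F] applies for n = 0
   too. *)
move=> n; rewrite mul0r -(aF n.+1)//; apply: eq_mCint => t _.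
by rewrite exprS mulrA.
Qed.

Lemma ext_mul_poly F p w : sqnorm w < 1 -> bounded_Cmfun F -> analytic F ->
  ext (fun t => F t * p.[expi t]) w = p.[w] * ext F w.
Proof.
move=> w1 bF aF; elim/poly_ind: p => [|p c IH].
  rewrite horner0 mul0r -(ext_cst 0 w1); apply: eq_mCint => t _.
  by rewrite horner0 mulr0.
have bp := bounded_CmfunM_poly p bF.
transitivity (ext (fun t => F t * p.[expi t] * expi t + c * F t) w).
  by apply: eq_mCint => t _; rewrite hornerMXaddC; ring.
rewrite extD ?extZ ?ext_mulX//; first last.
- by apply: bounded_CmfunM => //; exact: bounded_Cmfun_cst.
- by apply: bounded_CmfunM => //; exact: bounded_Cmfun_expi.
- exact: analyticM_poly.
by rewrite IH hornerMXaddC; ring.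
Qed.

End fourier.

(** * Products of analytic functions *)

Section analytic_products.
Variable R : realType.
Implicit Types (F G u : R -> R[i]) (c v w : R[i]).

(** A trigonometric polynomial split by frequency. The factor xi in front of [q] leaves the constant
    term to [p], so the conjugated part has strictly negative frequencies and is orthogonal to
    analytic functions. *)
Definition trig_eval (p q : {poly R[i]}) (t : R) : R[i] :=
  p.[expi t] + conjc (expi t * q.[expi t]).

(** Approximation is in L^2, a notion that survives bounded pointwise limits, as the monotone class
    theorem requires. *)
Definition trig_approx F : Prop := forall e : R, 0 < e ->
  exists p q, mRint (fun t => sqnorm (F t - trig_eval p q t)) < e.

Lemma bounded_Cmfun_trig p q : bounded_Cmfun (trig_eval p q).
Proof.
apply: bounded_CmfunD; first exact: bounded_Cmfun_poly.
apply: bounded_Cmfun_conj; apply: bounded_CmfunM.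
  exact: bounded_Cmfun_expi.
exact: bounded_Cmfun_poly.
Qed.

Lemma integrable_sqnorm F : bounded_Cmfun F ->
  circle_integrable (fun t => sqnorm (F t)).
Proof. by move=> bF; exact/bounded_circle_integrable/bounded_mfun_sqnorm. Qed.

Lemma mRint_sqnormD_le F G : bounded_Cmfun F -> bounded_Cmfun G ->
  mRint (fun t => sqnorm (F t + G t)) <=
  2 * mRint (fun t => sqnorm (F t)) + 2 * mRint (fun t => sqnorm (G t)).
Proof.
move=> bF bG; have iF := integrable_sqnorm bF; have iG := integrable_sqnorm bG.
rewrite -!mRintZ// -mRintD; [|exact: circle_integrableZ..].
apply: le_mRint; first exact/integrable_sqnorm/bounded_CmfunD.
  by apply: circle_integrableD; exact: circle_integrableZ.
by move=> t _; exact: sqnormD_le.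
Qed.

Lemma trig_approxD F G : bounded_Cmfun F -> bounded_Cmfun G ->
  trig_approx F -> trig_approx G -> trig_approx (fun t => F t + G t).
Proof.
move=> bF bG aF aG e e0.
have [|p [q pq]] := aF (e / 4); first by rewrite divr_gt0.
have [|p' [q' pq']] := aG (e / 4); first by rewrite divr_gt0.
exists (p + p'), (q + q'); apply: le_lt_trans
  (_ : _ <= mRint (fun t => sqnorm ((F t - trig_eval p q t) +
                                    (G t - trig_eval p' q' t)))) _.
  rewrite le_eqVlt; apply/orP; left; apply/eqP; apply: eq_mRint => t _.
  by congr sqnorm; rewrite /trig_eval !hornerD mulrDr conjcD; ring.
apply: le_lt_trans (mRint_sqnormD_le _ _) _.
- by apply: bounded_CmfunB => //; exact: bounded_Cmfun_trig.
- by apply: bounded_CmfunB => //; exact: bounded_Cmfun_trig.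
by lra.
Qed.

Lemma trig_approxZ c F : bounded_Cmfun F ->
  trig_approx F -> trig_approx (fun t => c * F t).
Proof.
move=> bF aF e e0; have c0 : 0 < sqnorm c + 1 by rewrite ltr_wpDl// sqnorm_ge0.
have [|p [q pq]] := aF (e / (sqnorm c + 1)); first by rewrite divr_gt0.
exists (c *: p), (conjc c *: q).
have bd : bounded_Cmfun (fun t => F t - trig_eval p q t).
  by apply: bounded_CmfunB => //; exact: bounded_Cmfun_trig.
rewrite (eq_mRint (g := fun t => sqnorm c * sqnorm (F t - trig_eval p q t))).
  rewrite mRintZ; last exact: integrable_sqnorm.
  rewrite ltr_pdivlMr// in pq; apply: le_lt_trans pq.
  rewrite mulrC ler_wpM2l ?lerDl//; apply: mRint_ge0 => t _; exact: sqnorm_ge0.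
move=> t _; rewrite -sqnormM; congr sqnorm.
rewrite /trig_eval !hornerZ !conjcM.
have -> : conjc (conjc c) = c by apply: complex_ext; rewrite !reimE ?opprK.
by ring.
Qed.

Lemma trig_approx_cvg (f_ : nat -> R -> R) (f : R -> R) (C : R) :
  (forall n, bounded_mfun Dom (f_ n)) -> bounded_mfun Dom f ->
  (forall n, trig_approx (fun t => (f_ n t)%:C%C)) ->
  (forall n t, Dom t -> `|f_ n t| <= C) ->
  (forall t, Dom t -> f_ n t @[n --> \oo] --> f t) ->
  trig_approx (fun t => (f t)%:C%C).
Proof.
move=> bf_ bf af fC ff e e0.
have lim0 : mRint (fun t => (f t - f_ n t) ^+ 2) @[n --> \oo] --> (0 : R).
  have [C' fC'] := bf.2.
  rewrite -(mRint_cst (0 : R)); apply: (@mRint_cvg _ _ _ ((C' + C) ^+ 2)).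
  - by move=> n; exact: (bounded_mfun_sqr (bounded_mfunB bf (bf_ n))).1.
  - move=> n t Dt; rewrite normrX lerXn2r ?nnegrE//.
      by rewrite addr_ge0// (le_trans (normr_ge0 _) (fC' t Dt), le_trans (normr_ge0 _) (fC n t Dt)).
    by apply: le_trans (ler_normB _ _) _; apply: lerD; [exact: fC'|exact: fC].
  - move=> t Dt; rewrite (_ : 0 = (f t - f t) * (f t - f t)); last by rewrite subrr mulr0.
    under eq_fun do rewrite expr2.
    by apply: cvgM; (apply: cvgB; [exact: cvg_cst|exact: ff]).
(* A quarter for each error, because |a + b|^2 <= 2|a|^2 + 2|b|^2. *)
have e4 : 0 < e / 4 by rewrite divr_gt0.
have [n hn] : exists n, mRint (fun t => (f t - f_ n t) ^+ 2) < e / 4.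
  have [N _ hN] := @cvgr_lt _ _ _ _ _ _ lim0 _ e4.
  by exists N; apply: hN => /=.
have [p [q pq]] := af n _ e4.
exists p, q; apply: le_lt_trans
  (_ : _ <= mRint (fun t => sqnorm ((f t - f_ n t)%:C%C +
                                    ((f_ n t)%:C%C - trig_eval p q t)))) _.
  rewrite le_eqVlt; apply/orP; left; apply/eqP; apply: eq_mRint => t _.
  by congr sqnorm; rewrite rmorphB /=; ring.
apply: le_lt_trans (mRint_sqnormD_le _ _) _.
- exact/bounded_Cmfun_real/bounded_mfunB.
- apply: bounded_CmfunB; [exact: bounded_Cmfun_real|exact: bounded_Cmfun_trig].
rewrite (eq_mRint (g := fun t => (f t - f_ n t) ^+ 2)); first by lra.
by move=> t _; rewrite /sqnorm /= expr0n addr0.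
Qed.

Lemma trig_approx_exact F p q : (forall t, F t = trig_eval p q t) -> trig_approx F.
Proof.
move=> E e e0; exists p, q; rewrite (eq_mRint (g := fun=> 0)) ?mRint_cst//.
by move=> t _; rewrite E subrr sqnorm0.
Qed.

Lemma trig_approx_cos (k : nat) s :
  trig_approx (fun t => (cos (k%:R * (t - s)))%:C%C).
Proof.
case: k => [|k].
  apply: (@trig_approx_exact _ 1 0) => t.
  rewrite mul0r cos0 /trig_eval hornerC horner0 mulr0.
  by apply: complex_ext; rewrite !reimE /= ?oppr0 ?addr0.
(* With this [a], the monomial a xi^(k+1) is half of exp(i(k+1)(t - s)), and the cosine is the
   monomial plus its conjugate. In [q] the exponent is k, since [trig_eval] supplies one more xi. *)
pose a : R[i] := conjc (expi (k.+1%:R * s)) * (2^-1)%:C%C.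
suff E t : (cos (k.+1%:R * (t - s)))%:C%C = trig_eval (a *: 'X^(k.+1)) (a *: 'X^k) t.
  exact: trig_approx_exact E.
rewrite /trig_eval !hornerZ !hornerXn.
rewrite [expi t * _]mulrCA -exprS expiX /a mulrBr.
by apply: complex_ext; rewrite !reimE /= ?cosB; field.
Qed.

Lemma trig_approx_real (g : R -> R) : bounded_mfun Dom g ->
  trig_approx (fun t => (g t)%:C%C).
Proof.
move=> bg; pose M (h : R -> R) := bounded_mfun Dom h /\ trig_approx (fun t => (h t)%:C%C).
suff [] : M g by [].
apply: trig_monotone_class bg => {g}.
- by move=> h [[_ ?] _].
- move=> h k [bh ah] [bk ak]; split; first exact: bounded_mfunD.
  under eq_fun do rewrite rmorphD /=.
  by apply: trig_approxD => //; exact: bounded_Cmfun_real.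
- move=> c h [bh ah]; split; first exact: bounded_mfunZ.
  under eq_fun do rewrite rmorphM /=.
  by apply: trig_approxZ => //; exact: bounded_Cmfun_real.
- move=> h_ h C Mh hC hh.
  have bh : bounded_mfun Dom h.
    by apply: bounded_mfun_lim hC hh => // n; exact: (Mh n).1.1.
  split => //; apply: (trig_approx_cvg _ bh _ hC hh) => n; [exact: (Mh n).1|exact: (Mh n).2].
- move=> k s; split; last exact: trig_approx_cos.
  split; last by exists 1 => t _; exact: cos_max.
  apply: measurable_funS (measurableT) _ (continuous_measurable_fun _) => //.
  move=> x; apply: continuous_comp; last exact: continuous_cos.
  apply: continuousM; first exact: cst_continuous.
  by apply: continuousB; [exact: cvg_id|exact: cst_continuous].
Qed.

Lemma trig_approx_bounded F : bounded_Cmfun F -> trig_approx F.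
Proof.
move=> [bR bI]; rewrite (_ : F = fun t => (complex.Re (F t))%:C%C +
    'i%C * (complex.Im (F t))%:C%C); last first.
  by apply/funext => t; exact: complexE.
apply: trig_approxD.
- exact: bounded_Cmfun_real.
- by apply: bounded_CmfunM; [exact: bounded_Cmfun_cst|exact: bounded_Cmfun_real].
- exact: trig_approx_real.
by apply: trig_approxZ; [exact: bounded_Cmfun_real|exact: trig_approx_real].
Qed.

(* If [p + conj(xi q)] is close to [F] then so is [p], because [F - p] is
   orthogonal to [conj(xi q)]. *)
Lemma analytic_approx F (e : R) : bounded_Cmfun F -> analytic F -> 0 < e ->
  exists p : {poly R[i]}, mRint (fun t => sqnorm (F t - p.[expi t])) < e.
Proof.
move=> bF aF e0; have [p [q pq]] := trig_approx_bounded bF e0.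
exists p; apply: le_lt_trans pq.
have bp := bounded_Cmfun_poly p; have bq := bounded_Cmfun_poly q.
have bX : bounded_Cmfun (fun t => expi t * q.[expi t]).
  by apply: bounded_CmfunM => //; exact: bounded_Cmfun_expi.
have bFp : bounded_Cmfun (fun t => F t - p.[expi t]) by exact: bounded_CmfunB.
have aFp : analytic (fun t => F t - p.[expi t]).
  move=> n n0; under [X in mCint X]eq_fun do rewrite mulrBl.
  rewrite mCintB; [|exact/bounded_Cintegrable/bounded_CmfunM_expiX..].
  have -> : mCint (fun t => p.[expi t] * expi t ^+ n) = 0.
    rewrite -[RHS](analyticM_poly p (bounded_Cmfun_cst 1) (analytic_cst 1) n0).
    by apply: eq_mCint => t _; rewrite mul1r.
  by rewrite aF// subr0.
have orth : mCint (fun t => (F t - p.[expi t]) * (expi t * q.[expi t])) = 0.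
  rewrite -(analyticM_poly q bFp aFp (ltn0Sn 0)); apply: eq_mCint => t _.
  by rewrite expr1; ring.
rewrite (eq_mRint (g := fun t => sqnorm (F t - p.[expi t]) +
    sqnorm (expi t * q.[expi t]) -
    2 * complex.Re ((F t - p.[expi t]) * (expi t * q.[expi t])))
    (f := fun t => sqnorm (F t - trig_eval p q t))); last first.
  move=> t _; rewrite /trig_eval opprD addrA sqnormB sqnorm_conj.
  by congr (_ - 2 * complex.Re (_ * _)); apply: complex_ext; rewrite !reimE ?opprK.
have i1 := integrable_sqnorm bFp; have i2 := integrable_sqnorm bX.
have i3 := (bounded_Cintegrable (bounded_CmfunM bFp bX)).1.
rewrite mRintB; [|exact: circle_integrableD|exact: circle_integrableZ].
rewrite mRintD// mRintZ//.
have -> : mRint (fun t => complex.Re ((F t - p.[expi t]) * (expi t * q.[expi t]))) = 0.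
  by case: orth.
by rewrite mulr0 subr0 lerDl; apply: mRint_ge0 => t _; exact: sqnorm_ge0.
Qed.

(** * Multiplicativity by polynomial approximation *)

Lemma sqnorm_eq0_small (z : R[i]) (K : R) :
  (forall e, 0 < e -> sqnorm z <= K * e) -> z = 0.
Proof.
move=> h; apply: sqnorm_eq0; apply/eqP; rewrite eq_le sqnorm_ge0 andbT.
apply/ler_addgt0Pr => e e0; rewrite add0r.
have K0 : 0 < `|K| + 1 by rewrite ltr_wpDl.
apply: le_trans (h (e / (`|K| + 1)) _) _; first by rewrite divr_gt0.
rewrite mulrA ler_pdivrMr// mulrC ler_wpM2l ?(ltW e0)//.
by rewrite (le_trans (ler_norm _))// lerDl.
Qed.

(** L^2 continuity of G -> int F G, with a constant taken from the bound on |F|^2. It controls the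
    error when an analytic factor is replaced by a polynomial. *)
Lemma sqnorm_mCintM_bound F : bounded_Cmfun F -> exists2 K : R, 0 <= K & forall G,
  bounded_Cmfun G ->
  sqnorm (mCint (fun t => F t * G t)) <= K * mRint (fun t => sqnorm (G t)).
Proof.
move=> bF; have [K hK] := (bounded_mfun_sqnorm bF).2.
exists `|K| => // G bG; have iG := integrable_sqnorm bG.
apply: le_trans (sqnorm_mCint_le (bounded_CmfunM bF bG)) _.
rewrite -mRintZ//; apply: le_mRint.
- exact/integrable_sqnorm/bounded_CmfunM.
- exact: circle_integrableZ.
move=> t Dt; rewrite sqnormM ler_wpM2r ?sqnorm_ge0//.
by apply: le_trans (ler_norm _) _; apply: le_trans (hK _ Dt) (ler_norm _).
Qed.

(** If [p] approximates [u] in L^2, then F p is analytic, so each positive moment of F u equals that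
    of F (u - p) and is arbitrarily small. *)
Lemma analyticM F u : bounded_Cmfun F -> bounded_Cmfun u ->
  analytic F -> analytic u -> analytic (fun t => F t * u t).
Proof.
move=> bF bu aF au n n0.
have bFn := bounded_CmfunM_expiX n bF.
have [K K0 hK] := sqnorm_mCintM_bound bFn.
apply: (@sqnorm_eq0_small _ K) => e e0.
have [p hp] := analytic_approx bu au e0.
have bup : bounded_Cmfun (fun t => u t - p.[expi t]).
  by apply: bounded_CmfunB => //; exact: bounded_Cmfun_poly.
have -> : mCint (fun t => F t * u t * expi t ^+ n) =
    mCint (fun t => F t * expi t ^+ n * (u t - p.[expi t])).
  apply/eqP; rewrite -subr_eq0 -mCintB; last 2 first.
  - exact/bounded_Cintegrable/bounded_CmfunM_expiX/bounded_CmfunM.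
  - exact/bounded_Cintegrable/bounded_CmfunM.
  rewrite -(analyticM_poly p bF aF n0); apply/eqP; apply: eq_mCint => t _; ring.
by apply: le_trans (hK _ bup) _; rewrite ler_wpM2l// ltW.
Qed.

(** The rule is exact when [u] is a polynomial, by [ext_mul_poly]. Replacing [u] by an L^2
    approximation [p] leaves two errors, one in the Poisson integral of F u and one in that of [u],
    and the terms p(w) [ext F w] cancel. *)
Lemma extM F u w : sqnorm w < 1 -> bounded_Cmfun F -> bounded_Cmfun u ->
  analytic F -> analytic u -> ext (fun t => F t * u t) w = ext F w * ext u w.
Proof.
move=> w1 bF bu aF au.
have bP := bounded_Cmfun_real (bounded_poisson w1).
have [K K0 hK] := sqnorm_mCintM_bound (bounded_CmfunM bP bF).
have [L L0 hL] := sqnorm_mCintM_bound bP.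
apply/eqP; rewrite -subr_eq0; apply/eqP.
apply: (@sqnorm_eq0_small _ (2 * K + 2 * (sqnorm (ext F w) * L))) => e e0.
have [p hp] := analytic_approx bu au e0.
have bp := bounded_Cmfun_poly p.
have bup : bounded_Cmfun (fun t => u t - p.[expi t]) by exact: bounded_CmfunB.
have E1 : ext (fun t => F t * u t) w =
    mCint (fun t => (poisson w t)%:C%C * F t * (u t - p.[expi t])) + p.[w] * ext F w.
  rewrite -ext_mul_poly// /ext -mCintD; last 2 first.
  - by apply/bounded_Cintegrable/bounded_CmfunM => //; exact: bounded_CmfunM.
  - exact/bounded_Cintegrable/bounded_CmfunM_poisson/bounded_CmfunM.
  by apply: eq_mCint => t _; ring.
have E2 : ext u w = mCint (fun t => (poisson w t)%:C%C * (u t - p.[expi t])) + p.[w].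
  rewrite -[X in _ + X]mulr1 -[X in _ * X](ext_cst 1 w1).
  rewrite -(ext_mul_poly p w1 (bounded_Cmfun_cst 1) (analytic_cst 1)) /ext -mCintD.
  - by apply: eq_mCint => t _; ring.
  - exact/bounded_Cintegrable/bounded_CmfunM_poisson.
  - by apply/bounded_Cintegrable/bounded_CmfunM_poisson/bounded_CmfunM => //;
      exact: bounded_Cmfun_cst.
rewrite E1 E2 (_ : _ - _ = mCint (fun t => (poisson w t)%:C%C * F t * (u t - p.[expi t]))
  - ext F w * mCint (fun t => (poisson w t)%:C%C * (u t - p.[expi t]))); last by ring.
apply: le_trans (sqnormD_le _ _) _; rewrite sqnormN sqnormM [leRHS]mulrDl.
have h1 := le_trans (hK _ bup) (ler_wpM2l K0 (ltW hp)).
have h2 := le_trans (hL _ bup) (ler_wpM2l L0 (ltW hp)).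
by apply: lerD; rewrite -!mulrA ler_wpM2l// ler_wpM2l// sqnorm_ge0.
Qed.

Lemma analyticX u n : bounded_Cmfun u -> analytic u -> analytic (fun t => u t ^+ n).
Proof.
move=> bu au; elim: n => [|n IH]; first exact: analytic_cst.
under eq_fun do rewrite exprS.
by apply: analyticM => //; exact: bounded_CmfunX.
Qed.

Lemma extX u w n : sqnorm w < 1 -> bounded_Cmfun u -> analytic u ->
  ext (fun t => u t ^+ n) w = ext u w ^+ n.
Proof.
move=> w1 bu au; elim: n => [|n IH]; first exact: ext_cst.
under [X in ext X]eq_fun do rewrite exprS.
by rewrite extM ?IH ?exprS//; [exact: bounded_CmfunX|exact: analyticX].
Qed.

Lemma ext_expi w : sqnorm w < 1 -> ext (@expi R) w = w.
Proof.
move=> w1; rewrite -[RHS]mulr1 -(ext_cst 1 w1).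
rewrite -(ext_mulX w1 (bounded_Cmfun_cst 1) (analytic_cst 1)).
by under [in RHS]eq_fun do rewrite mul1r.
Qed.

Lemma analytic_expi : analytic (@expi R).
Proof. by move=> n n0; under [X in mCint X]eq_fun do rewrite -exprS; exact: mCint_expiX. Qed.

(** By [extX] the moments int P_w u^n dm are the powers of [ext u w], as [mCint_resolvent] asks;
    [poissonE] then takes real parts. *)
Lemma mRint_poisson_comp u lam w : bounded_Cmfun u -> analytic u ->
  (forall t, Dom t -> sqnorm (u t) = 1) ->
  sqnorm lam < 1 -> sqnorm w < 1 -> sqnorm (ext u w) <= 1 ->
  mRint (fun t => poisson w t * ((1 - sqnorm lam) / sqnorm (u t - lam))) =
  2 * complex.Re (1 - conjc lam * ext u w)^-1 - 1.
Proof.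
move=> bu au u1 l1 w1 v1; have cl1 : sqnorm (conjc lam) < 1 by rewrite sqnorm_conj.
have u1' t : Dom t -> sqnorm (u t) <= 1 by move=> /u1 ->.
have bV := bounded_Cmfun_resolvent bu u1' cl1.
have bP := bounded_poisson w1; have bPC := bounded_Cmfun_real bP.
have ER : mCint (fun t => (poisson w t)%:C%C / (1 - conjc lam * u t)) =
    1 / (1 - conjc lam * ext u w).
  by apply: mCint_resolvent => // n; rewrite mul1r -extX.
rewrite (eq_mRint (g := fun t =>
  2 * complex.Re ((poisson w t)%:C%C / (1 - conjc lam * u t)) - poisson w t)); last first.
  by move=> t Dt; rewrite poissonE ?u1// !reimE /=; ring.
have i1 := (bounded_Cintegrable (bounded_CmfunM bPC bV)).1.
rewrite mRintB; [|exact: circle_integrableZ|exact: bounded_circle_integrable].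
by rewrite mRint_poisson// mRintZ// -[in RHS]div1r -ER.
Qed.

(** By [mRint_poisson_comp] the left side depends on [u] and [w] only through v = [ext u w]. The
    identity function xi at the point v has the same Poisson integral v, hence gives the same
    value. *)
Lemma mRint_poisson_transfer u lam w : bounded_Cmfun u -> analytic u ->
  (forall t, Dom t -> sqnorm (u t) = 1) ->
  sqnorm lam < 1 -> sqnorm w < 1 -> sqnorm (ext u w) < 1 ->
  mRint (fun t => poisson w t * ((1 - sqnorm lam) / sqnorm (u t - lam))) =
  mRint (fun t => poisson lam t * poisson (ext u w) t).
Proof.
move=> bu au u1 l1 w1 v1; rewrite mRint_poisson_comp//; last exact: ltW.
under [in RHS]eq_fun do rewrite mulrC.
rewrite -{1}(ext_expi v1) -mRint_poisson_comp ?ext_expi ?ltW//.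
- exact: bounded_Cmfun_expi.
- exact: analytic_expi.
- by move=> t _; exact: sqnorm_expi.
Qed.

(** With v = [ext u w], the variance int P_w |u - v|^2 dm equals 1 - |v|^2. It is nonnegative, and
    since P_w > 0 it vanishes only if u = v almost everywhere. *)
Lemma sqnorm_ext_lt1 u w : bounded_Cmfun u ->
  (forall t, Dom t -> sqnorm (u t) = 1) -> nonconstant u -> sqnorm w < 1 ->
  sqnorm (ext u w) < 1.
Proof.
move=> bu u1 ncu w1; set v := ext u w.
have bP := bounded_poisson w1; have bPC := bounded_Cmfun_real bP.
have bd : bounded_Cmfun (fun t => u t - v).
  by apply: bounded_CmfunB => //; exact: bounded_Cmfun_cst.
have bPd := bounded_mfunM bP (bounded_mfun_sqnorm bd).
have E : mRint (fun t => poisson w t * sqnorm (u t - v)) = 1 - sqnorm v.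
  rewrite (eq_mRint (g := fun t => (1 + sqnorm v) * poisson w t -
      2 * complex.Re (conjc v * ((poisson w t)%:C%C * u t)))); last first.
    by move=> t Dt; rewrite sqnormB u1// !reimE /=; ring.
  have i := (bounded_Cintegrable (bounded_CmfunM (bounded_Cmfun_cst (conjc v))
    (bounded_CmfunM bPC bu))).1.
  have iP := bounded_circle_integrable bP.
  rewrite mRintB; [|exact: circle_integrableZ..].
  rewrite [X in X - _]mRintZ// mRint_poisson// mRintZ//.
  have -> : mRint (fun t => complex.Re (conjc v * ((poisson w t)%:C%C * u t))) = sqnorm v.
    transitivity (complex.Re (mCint (fun t => conjc v * ((poisson w t)%:C%C * u t)))).
      by [].
    rewrite mCintZ; last exact/bounded_Cintegrable/bounded_CmfunM.
    by rewrite -/(ext u w) -/v mulrC mul_conjcE.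
  by ring.
rewrite -subr_gt0 -E lt_neqAle mRint_ge0 ?andbT; last first.
  by move=> t _; rewrite mulr_ge0 ?sqnorm_ge0// ltW// poisson_gt0.
apply/eqP => /esym E0; apply: ncu; exists v.
have iPd := bounded_circle_integrable bPd.
pose g t := poisson w t * sqnorm (u t - v).
have finPd := @integrable_fin_num _ (measurableTypeR R) _ lebesgue_measure Dom
  (@measurable_Dom R) _ iPd.
have I0 : (\int[@lebesgue_measure R]_(t in Dom) `|(EFin \o g) t| = 0)%E.
  transitivity (\int[@lebesgue_measure R]_(t in Dom) (EFin \o g) t)%E.
    apply: eq_integral => t _; rewrite gee0_abs//.
    by rewrite lee_fin mulr_ge0 ?sqnorm_ge0// ltW// poisson_gt0.
  rewrite -(fineK finPd); congr EFin; move/eqP: E0.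
  rewrite mulf_eq0 invr_eq0 gt_eqF ?twopi_gt0//= => /eqP; exact.
have mPd : measurable_fun (Dom : set (measurableTypeR R))
    (EFin \o g).
  by apply/measurable_EFinP; exact: bPd.1.
have [+ _] := @ae_eq_integral_abs _ _ _ lebesgue_measure _ (@measurable_Dom R) _ mPd.
move=> /(_ I0); apply: negligibleS => t /= [Dt nuv] /(_ Dt) /eqP.
rewrite eqe mulf_eq0 gt_eqF ?poisson_gt0//= => /eqP /sqnorm_eq0 /eqP.
by rewrite subr_eq0 => /eqP.
Qed.

End analytic_products.

(** * Disintegration along Clark measures *)

Section clark_measures.
Variables (R : realType) (u : R -> R[i]) (sigma : R -> {measure set R -> \bar R}).
Hypothesis bu : bounded_Cmfun u.
Hypothesis u1 : forall t, Dom t -> sqnorm (u t) = 1.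
Hypothesis au : analytic u.
Hypothesis ncu : nonconstant u.
Hypothesis clark : clark_family u sigma.
Implicit Types (g f : R -> R) (lam w : R[i]).

Lemma poisson0 (t : R) : poisson 0 t = 1.
Proof. by rewrite /poisson sqnorm0 !subr0 sqnorm_expi divr1. Qed.

(** At z = 0 the Poisson kernel is 1, so the defining identity reads off the total mass. *)
Lemma clark_mass a : Dom a -> sigma a Dom = (poisson (ext u 0) a)%:E.
Proof.
move=> Da; have := clark Da (z := 0); rewrite sqnorm0 => /(_ ltr01) ->.
under eq_integral do rewrite poisson0.
by rewrite (integral_cst (sigma a) (@measurable_Dom R) 1%:E) mul1e.
Qed.

Lemma clark_mass_lty a : Dom a -> (sigma a Dom < +oo)%E.
Proof. by move=> Da; rewrite clark_mass// ltry. Qed.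

Lemma sqnorm_ext0_lt1 : sqnorm (ext u 0) < 1.
Proof. by apply: sqnorm_ext_lt1 => //; rewrite sqnorm0. Qed.

Definition clark_integral g (a : R) : R := \int[sigma a]_(t in Dom) g t.

Lemma clark_integral_poisson w a : sqnorm w < 1 -> Dom a ->
  clark_integral (poisson w) a = poisson (ext u w) a.
Proof. by move=> w1 Da; rewrite /clark_integral /Rintegral -clark. Qed.

Lemma clark_integral_le g C a : measurable_fun Dom g ->
  (forall t, Dom t -> `|g t| <= C) -> Dom a ->
  `|clark_integral g a| <= C * poisson (ext u 0) a.
Proof.
move=> mg gC Da; rewrite -[poisson _ _]/(fine (_%:E)) -clark_mass//.
by apply: Rintegral_le_bound => //; exact: clark_mass_lty.
Qed.

(** The total masses P_(u(0))(a) are bounded in [a] because |u(0)| < 1. As [K] depends on [C] only,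
    it dominates a whole sequence of integrals at once. *)
Lemma clark_integral_bound C : exists K, forall g, measurable_fun Dom g ->
  (forall t, Dom t -> `|g t| <= C) -> forall a, Dom a -> `|clark_integral g a| <= K.
Proof.
have [B hB] := (bounded_poisson sqnorm_ext0_lt1).2.
exists (`|C| * B) => g mg gC a Da; apply: le_trans (clark_integral_le mg gC Da) _.
apply: ler_pM => //; last by apply: le_trans (hB _ Da); exact: ler_norm.
- by apply: le_trans (gC _ Da).
- by rewrite ltW// poisson_gt0// sqnorm_ext0_lt1.
- exact: ler_norm.
Qed.

Lemma bounded_clark_integral g : bounded_mfun Dom g ->
  measurable_fun Dom (clark_integral g) -> bounded_mfun Dom (clark_integral g).
Proof.
move=> [mg [C gC]] mS; split => //.
have [K hK] := clark_integral_bound C.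
by exists K => a Da; exact: hK.
Qed.

Definition poisson_comp lam (t : R) : R := (1 - sqnorm lam) / sqnorm (u t - lam).

Lemma bounded_poisson_comp lam : sqnorm lam < 1 -> bounded_mfun Dom (poisson_comp lam).
Proof.
move=> l1; apply: bounded_mfunZ.
apply: (@bounded_mfunV _ _ _ _ _ ((1 - sqnorm lam) ^+ 2 / 4)).
- by rewrite divr_gt0// exprn_gt0// subr_gt0.
- by apply: (bounded_mfun_sqnorm _).1; apply: bounded_CmfunB => //;
    exact: bounded_Cmfun_cst.
- by move=> t Dt; apply: sqnormB_ge => //; exact: u1.
Qed.

Lemma poisson_comp_gt0 lam t : sqnorm lam < 1 -> Dom t -> 0 < poisson_comp lam t.
Proof. by move=> l1 Dt; rewrite divr_gt0 ?subr_gt0// sqnormB_gt0// u1. Qed.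

(** Measurability in alpha is part of the property, so that it is transported from the Poisson
    kernels by the same closure rules as the identity. *)
Definition disintegrates g : Prop :=
  [/\ bounded_mfun Dom g, measurable_fun Dom (clark_integral g) &
      forall lam, sqnorm lam < 1 ->
        mRint (fun a => poisson lam a * clark_integral g a) =
        mRint (fun t => poisson_comp lam t * g t)].

(** * Closure properties of the disintegration identity *)

Lemma clark_integralD f g a : bounded_mfun Dom f -> bounded_mfun Dom g -> Dom a ->
  clark_integral (fun t => f t + g t) a = clark_integral f a + clark_integral g a.
Proof.
move=> bf bg Da; have fin := clark_mass_lty Da.
by rewrite /clark_integral RintegralD//; exact: bounded_mfun_integrable.
Qed.

Lemma clark_integralZ c f a : bounded_mfun Dom f -> Dom a ->
  clark_integral (fun t => c * f t) a = c * clark_integral f a.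
Proof.
move=> bf Da; have fin := clark_mass_lty Da.
by rewrite /clark_integral RintegralZl//; exact: bounded_mfun_integrable.
Qed.

Lemma disintegratesD f g : disintegrates f -> disintegrates g ->
  disintegrates (fun t => f t + g t).
Proof.
move=> [bf mf hf] [bg mg hg].
have bSf := bounded_clark_integral bf mf; have bSg := bounded_clark_integral bg mg.
split; first exact: bounded_mfunD.
  apply: eq_measurable_fun (measurable_funD mf mg) => a; rewrite inE => Da.
  by rewrite clark_integralD.
move=> lam l1; have bP := bounded_poisson l1; have bC := bounded_poisson_comp l1.
rewrite (eq_mRint (g := fun a => poisson lam a * clark_integral f a +
    poisson lam a * clark_integral g a)); last first.
  by move=> a Da; rewrite clark_integralD// mulrDr.
under [in RHS]eq_fun do rewrite mulrDr.
by rewrite !mRintD ?hf ?hg//; apply: bounded_circle_integrable; exact: bounded_mfunM.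
Qed.

Lemma disintegratesZ c f : disintegrates f -> disintegrates (fun t => c * f t).
Proof.
move=> [bf mf hf]; have bSf := bounded_clark_integral bf mf.
split; first exact: bounded_mfunZ.
  apply: eq_measurable_fun (measurable_funM (measurable_cst c) mf) => a.
  by rewrite inE => Da; rewrite clark_integralZ.
move=> lam l1; have bP := bounded_poisson l1; have bC := bounded_poisson_comp l1.
rewrite (eq_mRint (g := fun a => c * (poisson lam a * clark_integral f a))); last first.
  by move=> a Da; rewrite clark_integralZ// mulrCA.
under [in RHS]eq_fun do rewrite mulrCA.
by rewrite !mRintZ ?hf//; apply: bounded_circle_integrable; exact: bounded_mfunM.
Qed.

(** Dominated convergence is used three times: in each finite measure sigma_a, then in m on either
    side of the identity. *)
Lemma disintegrates_lim (f_ : nat -> R -> R) f (C : R) :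
  (forall n, disintegrates (f_ n)) -> (forall n t, Dom t -> `|f_ n t| <= C) ->
  (forall t, Dom t -> f_ n t @[n --> \oo] --> f t) -> disintegrates f.
Proof.
move=> df fC ff.
have mf_ n : measurable_fun Dom (f_ n) by have [[]] := df n.
have bf : bounded_mfun Dom f by exact: bounded_mfun_lim mf_ fC ff.
have SfS a : Dom a -> clark_integral (f_ n) a @[n --> \oo] --> clark_integral f a.
  by move=> Da; exact: (Rintegral_bounded_cvg (@measurable_Dom R) (clark_mass_lty Da) mf_ fC ff).
have [K hK] := clark_integral_bound C.
have SC n a : Dom a -> `|clark_integral (f_ n) a| <= K by apply: hK => // t; exact: fC.
have mS : measurable_fun Dom (clark_integral f).
  by apply: measurable_fun_lim SfS => n; have [] := df n.
split => // lam l1; have [mP [B hB]] := bounded_poisson l1.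
have [mC [B' hB']] := bounded_poisson_comp l1.
have c1 : mRint (fun a => poisson lam a * clark_integral (f_ n) a) @[n --> \oo] -->
    mRint (fun a => poisson lam a * clark_integral f a).
  apply: (@mRint_cvg _ _ _ (B * K)).
  - by move=> n; apply: measurable_funM => //; have [] := df n.
  - by move=> n a Da; rewrite normrM ler_pM// ?hB ?SC.
  - by move=> a Da; apply: cvgM; [exact: cvg_cst|exact: SfS].
have c2 : mRint (fun t => poisson_comp lam t * f_ n t) @[n --> \oo] -->
    mRint (fun t => poisson_comp lam t * f t).
  apply: (@mRint_cvg _ _ _ (B' * C)).
  - by move=> n; apply: measurable_funM.
  - by move=> n t Dt; rewrite normrM ler_pM// ?hB' ?fC.
  - by move=> t Dt; apply: cvgM; [exact: cvg_cst|exact: ff].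
rewrite -(cvg_lim _ c1)//; apply: cvg_lim => //.
by rewrite (_ : (fun n => _) = fun n => mRint (fun t => poisson_comp lam t * f_ n t))//;
  apply/funext => n; have [_ _ ->] := df n.
Qed.

Lemma disintegrates_poisson w : sqnorm w < 1 -> disintegrates (poisson w).
Proof.
move=> w1; have v1 := sqnorm_ext_lt1 bu u1 ncu w1.
split; first exact: bounded_poisson.
  apply: eq_measurable_fun (bounded_poisson v1).1 => a; rewrite inE => Da.
  by rewrite clark_integral_poisson.
move=> lam l1; under [in RHS]eq_fun do rewrite mulrC.
rewrite mRint_poisson_transfer//; apply: eq_mRint => a Da.
by rewrite clark_integral_poisson.
Qed.

(* [Re (q^k / (1 - q))] on the circle, where [q = r exp(i x)] *)
Definition geom_tail (k : nat) (r x : R) : R :=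
  (cos (k%:R * x) - r * cos (k%:R * x - x)) / (1 - 2 * r * cos x + r ^+ 2).

Lemma geom_tail_den_ge (r x : R) : 0 <= r -> (1 - r) ^+ 2 <= 1 - 2 * r * cos x + r ^+ 2.
Proof. by move=> r0; have := cos_le1 x; nra. Qed.

(** [geom_tail k r x] is the sum over j >= 0 of r^j cos((k + j) x): the leading term is not
    multiplied by a power of r, so cos(kx) is recovered as r tends to 0. *)
Lemma geom_tailS k (r x : R) : 0 <= r < 1 ->
  geom_tail k r x = cos (k%:R * x) + r * geom_tail k.+1 r x.
Proof.
move=> /andP[r0 r1]; have D0 : 1 - 2 * r * cos x + r ^+ 2 != 0.
  apply: lt0r_neq0; apply: lt_le_trans (geom_tail_den_ge x r0).
  by rewrite exprn_gt0// subr_gt0.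
have kS : k.+1%:R * x = k%:R * x + x by rewrite -natr1 mulrDl mul1r.
rewrite /geom_tail kS addrK.
apply: (mulIf D0); rewrite divfK// mulrDl -[r * _ * _]mulrA divfK//.
by move: (k%:R * x) => y; rewrite cosB cosD; ring.
Qed.

(** The numerator is at most 1 + r <= 2 and the denominator at least (1 - r)^2 >= 1/4. *)
Lemma geom_tail_le k (r x : R) : 0 <= r <= 2^-1 -> `|geom_tail k r x| <= 8.
Proof.
move=> /andP[r0 r2]; have D0 : 4^-1 <= 1 - 2 * r * cos x + r ^+ 2.
  by apply: le_trans (geom_tail_den_ge x r0); nra.
have D1 : 0 < 1 - 2 * r * cos x + r ^+ 2 by apply: lt_le_trans D0; rewrite invr_gt0.
rewrite /geom_tail normrM normfV [X in _ / X]gtr0_norm// ler_pdivrMr//.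
apply: (@le_trans _ _ 2); last by lra.
apply: le_trans (ler_normB _ _) _; rewrite normrM (ger0_norm r0).
have := cos_max (k%:R * x); have := cos_max (k%:R * x - x).
by move: `|cos (_ - _)| => a; nra.
Qed.

Lemma disintegrates_cos_of_geom_tail k s :
  (forall r, 0 < r < 1 -> disintegrates (fun t => geom_tail k r (t - s))) ->
  disintegrates (fun t => cos (k%:R * (t - s))).
Proof.
(* The radii 1/(n + 2) tend to 0 and stay at most 1/2, the range of [geom_tail_le]. *)
move=> dk; pose r n : R := n.+2%:R^-1.
have r0 n : 0 < r n by rewrite invr_gt0.
have r2 n : r n <= 2^-1 by rewrite lef_pV2 ?posrE// ler_nat.
have r02 n : 0 <= r n <= 2^-1 by rewrite ltW//=.
have r1 n : 0 <= r n < 1 by rewrite ltW//= (le_lt_trans (r2 n))// invf_lt1 ?ltr1n.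
apply: (@disintegrates_lim (fun n t => geom_tail k (r n) (t - s)) _ 8).
- by move=> n; apply: dk; rewrite r0; have /andP[] := r1 n.
- by move=> n t _; exact: geom_tail_le.
move=> t _; apply/cvgrPdist_le => e e0.
have cr : 8 * r n @[n --> \oo] --> (0 : R).
  rewrite -(mulr0 8); apply: cvgM; first exact: cvg_cst.
  have := @cvg_harmonic R; rewrite -(cvg_shiftS (@harmonic R)); exact.
near=> n; rewrite (geom_tailS _ _ (r1 n)) opprD addrA subrr sub0r normrN.
rewrite normrM gtr0_norm// mulrC; apply: (@le_trans _ _ (8 * r n)).
  by rewrite ler_wpM2r ?geom_tail_le// ltW.
by near: n; apply: (cvgr_le _ cr).
Unshelve. all: by end_near. Qed.

(** The Fourier modes of the Poisson kernel are peeled off one at a time. The tail of order 0 is (1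
    + P_z) / 2 with z = r exp(is). If all tails of order k are covered, so is cos(kx) as their limit
    for r -> 0, and subtracting it and dividing by r gives order k + 1. Hence the induction is over
    all radii. *)
Lemma disintegrates_geom_tail k (r s : R) : 0 < r < 1 ->
  disintegrates (fun t => geom_tail k r (t - s)).
Proof.
elim: k r => [|k IH] r /[dup] r01 /andP[r0 r1].
  pose z : R[i] := r%:C%C * expi s.
  have z1 : sqnorm z < 1.
    by rewrite sqnormM sqnorm_expi mulr1 /sqnorm /= expr0n addr0 expr_lt1// ltW.
  have -> : (fun t => geom_tail 0 r (t - s)) = (fun t => 2^-1 * (poisson 0 t + poisson z t)).
    apply/funext => t; rewrite poisson0 /geom_tail mul0r cos0 sub0r cosN /poisson.
    have -> : sqnorm (expi t - z) = 1 - 2 * r * cos (t - s) + r ^+ 2.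
      rewrite sqnormB sqnorm_expi sqnormM sqnorm_expi mulr1 {1}/sqnorm /= expr0n addr0.
      by rewrite cosB; ring.
    have -> : sqnorm z = r ^+ 2.
      by rewrite sqnormM sqnorm_expi mulr1 /sqnorm /= expr0n addr0.
    have D0 : 1 - 2 * r * cos (t - s) + r ^+ 2 != 0.
      apply: lt0r_neq0; apply: lt_le_trans (geom_tail_den_ge _ (ltW r0)).
      by rewrite exprn_gt0// subr_gt0.
    by field.
  apply: disintegratesZ; apply: disintegratesD; apply: disintegrates_poisson => //.
  by rewrite sqnorm0.
have -> : (fun t => geom_tail k.+1 r (t - s)) =
    (fun t => r^-1 * (geom_tail k r (t - s) + - 1 * cos (k%:R * (t - s)))).
  apply/funext => t; rewrite [in RHS]geom_tailS ?(ltW r0)//.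
  by field; rewrite gt_eqF.
apply: disintegratesZ; apply: disintegratesD; first exact: IH.
by apply: disintegratesZ; apply: disintegrates_cos_of_geom_tail => ?; exact: IH.
Qed.

Lemma disintegrates_bounded g : bounded_mfun Dom g -> disintegrates g.
Proof.
move: g; apply: trig_monotone_class.
- by move=> f [[_ ?]].
- exact: disintegratesD.
- exact: disintegratesZ.
- exact: disintegrates_lim.
- move=> k s; apply: disintegrates_cos_of_geom_tail => r.
  exact: disintegrates_geom_tail.
Qed.

(** * Extended-real integrals and nonnegative functions *)

Lemma clark_integral_fin g a : bounded_mfun Dom g -> Dom a ->
  (clark_integral g a)%:E = (\int[sigma a]_(t in Dom) (g t)%:E)%E.
Proof.
move=> bg Da; rewrite fineK//; apply: integrable_fin_num => //.
exact: (bounded_mfun_integrable (@measurable_Dom R) (clark_mass_lty Da) bg).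
Qed.

Lemma mRint_fin g : circle_integrable g -> (mRint g)%:E = mint (EFin \o g).
Proof.
move=> ig; rewrite /mRint EFinM fineK//.
exact: (@integrable_fin_num _ (measurableTypeR R) _ lebesgue_measure Dom
  (@measurable_Dom R) _ ig).
Qed.

Lemma mint_monotone_cvg (f_ : nat -> R -> \bar R) (f : R -> \bar R) :
  (forall n, measurable_fun Dom (f_ n)) ->
  (forall n t, Dom t -> (0 <= f_ n t)%E) ->
  (forall t, Dom t -> {homo f_^~ t : n m / (n <= m)%N >-> (n <= m)%E}) ->
  (forall t, Dom t -> f_ n t @[n --> \oo] --> f t) ->
  mint (f_ n) @[n --> \oo] --> mint f.
Proof.
move=> mf f0 nd ff; apply: cvgeZl => //.
exact: (ge0_nd_integral_cvg (@measurable_Dom R : @measurable _ (measurableTypeR R) Dom)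
  mf f0 nd ff).
Qed.

(** The inner integral may be infinite, so the identity is stated in [\bar R]. The truncations
    min(g, n) are bounded, and monotone convergence is applied inside sigma_a and then in m. *)
Lemma clark_disintegration g : measurable_fun Dom g ->
  (forall t, Dom t -> 0 <= g t) -> forall lam, sqnorm lam < 1 ->
  mint (fun a => (poisson lam a)%:E * \int[sigma a]_(t in Dom) (g t)%:E)%E =
  mint (fun t => (poisson_comp lam t * g t)%:E).
Proof.
move=> mg g0 lam l1.
pose g_ n t := Num.min (g t) n%:R.
have g_0 n t : Dom t -> 0 <= g_ n t by move=> Dt; rewrite le_min g0//=.
have bg n : bounded_mfun Dom (g_ n).
  split; first by apply: measurable_minr.
  by exists n%:R => t Dt; rewrite ger0_norm ?g_0// ge_min lexx orbT.
have nd t : {homo g_^~ t : n m / (n <= m)%N >-> n <= m}.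
  by move=> n m nm; rewrite le_min !ge_min lexx/= ler_nat nm orbT.
have g_g t : Dom t -> (g_ n t)%:E @[n --> \oo] --> (g t)%:E.
  move=> Dt; apply: cvg_near_cst; near=> n; congr EFin; apply/min_idPl.
  by near: n; exact: nbhs_infty_ger.
pose h_ n a := (clark_integral (g_ n) a)%:E.
pose h a := (\int[sigma a]_(t in Dom) (g t)%:E)%E.
have h_h a : Dom a -> h_ n a @[n --> \oo] --> h a.
  move=> Da; under eq_fun do rewrite /h_ clark_integral_fin//.
  apply: (ge0_nd_integral_cvg (@measurable_Dom R) _ _ _ g_g).
  - by move=> n; apply/measurable_EFinP; exact: (bg n).1.
  - by move=> n t Dt; rewrite lee_fin g_0.
  - by move=> t _ n m nm; rewrite lee_fin nd.
have dg n := disintegrates_bounded (bg n).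
have S0 n a : 0 <= clark_integral (g_ n) a by apply: Rintegral_ge0 => t; exact: g_0.
have bS n : bounded_mfun Dom (clark_integral (g_ n)).
  by apply: bounded_clark_integral => //; have [] := dg n.
have bP := bounded_poisson l1; have bC := bounded_poisson_comp l1.
have P0 a : 0 <= poisson lam a by rewrite ltW// poisson_gt0.
have C0 t : Dom t -> 0 <= poisson_comp lam t.
  by move=> Dt; rewrite ltW// poisson_comp_gt0.
have c1 : mint (fun a => (poisson lam a)%:E * h_ n a)%E @[n --> \oo] -->
    mint (fun a => (poisson lam a)%:E * h a)%E.
  apply: mint_monotone_cvg.
  - move=> n; apply/measurable_EFinP.
    by apply: measurable_funM; [exact: bP.1|exact: (bS n).1].
  - by move=> n a Da; rewrite mule_ge0// lee_fin.
  - move=> a Da n m nm; rewrite /h_ -!EFinM lee_fin ler_wpM2l//.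
    rewrite -lee_fin !clark_integral_fin//; apply: ge0_le_integral => //.
    + by move=> t Dt; rewrite lee_fin g_0.
    + by apply/measurable_EFinP; exact: (bg n).1.
    + by apply/measurable_EFinP; exact: (bg m).1.
    + by move=> t Dt; rewrite lee_fin nd.
  - by move=> a Da; apply: cvgeZl => //; exact: h_h.
have c2 : mint (fun t => (poisson_comp lam t * g_ n t)%:E) @[n --> \oo] -->
    mint (fun t => (poisson_comp lam t * g t)%:E).
  apply: mint_monotone_cvg.
  - move=> n; apply/measurable_EFinP.
    by apply: measurable_funM; [exact: bC.1|exact: (bg n).1].
  - by move=> n t Dt; rewrite lee_fin mulr_ge0 ?C0 ?g_0.
  - by move=> t Dt n m nm; rewrite lee_fin ler_wpM2l ?C0 ?nd.
  - by move=> t Dt; under eq_fun do rewrite EFinM; rewrite EFinM; apply: cvgeZl => //; exact: g_g.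
rewrite -(cvg_lim _ c1)//; apply: cvg_lim => //.
rewrite (_ : (fun n => _) = fun n => mint (fun t => (poisson_comp lam t * g_ n t)%:E))//.
apply/funext => n.
transitivity (mRint (fun a => poisson lam a * clark_integral (g_ n) a))%:E.
  rewrite mRint_fin//; apply: bounded_circle_integrable; exact: bounded_mfunM.
have [_ _ ->//] := dg n.
by rewrite mRint_fin//; apply: bounded_circle_integrable; exact: bounded_mfunM.
Unshelve. all: by end_near. Qed.

End clark_measures.

(** * The spectral measure of multiplication by an inner function *)

Section almost_everywhere.
Variable R : realType.
Implicit Types (P Q S : R -> Prop) (F G f y z : R -> R[i]).

Lemma ae_T_imp2 P Q S : (forall t, Dom t -> P t -> Q t -> S t) ->
  ae_T P -> ae_T Q -> ae_T S.
Proof.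
move=> PQS aP aQ; apply: negligibleS (negligibleU aP aQ) => t /= [Dt nS].
have [Pt|nP] := pselect (P t); last by left.
by right; split => // Qt; exact/nS/PQS.
Qed.

Lemma ae_T_imp P S : (forall t, Dom t -> P t -> S t) -> ae_T P -> ae_T S.
Proof. by move=> PS aP; apply: (ae_T_imp2 _ aP aP) => t Dt Pt _; exact: PS. Qed.

Lemma cmeasurableM F G : cmeasurable F -> cmeasurable G ->
  cmeasurable (fun t => F t * G t).
Proof.
move=> [? ?] [? ?]; split; under eq_fun do rewrite reimE.
  by apply: measurable_funB; exact: measurable_funM.
by apply: measurable_funD; exact: measurable_funM.
Qed.

Lemma cmeasurable_conj F : cmeasurable F -> cmeasurable (fun t => conjc (F t)).
Proof.
by move=> [? ?]; split; under eq_fun do rewrite reimE; [|exact: measurable_funN].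
Qed.

Lemma cmeasurableB F G : cmeasurable F -> cmeasurable G ->
  cmeasurable (fun t => F t - G t).
Proof.
move=> [? ?] [? ?].
by split; under eq_fun do rewrite !reimE; exact: measurable_funB.
Qed.

Lemma bounded_cmeasurable F : bounded_Cmfun F -> cmeasurable F.
Proof. by move=> [[? _] [? _]]. Qed.

Lemma measurable_sqnorm F : cmeasurable F -> measurable_fun Dom (fun t => sqnorm (F t)).
Proof. by move=> [? ?]; apply: measurable_funD; exact: measurable_funX. Qed.

Lemma H2_sqnorm_integrable F : H2 F -> circle_integrable (fun t => sqnorm (F t)).
Proof.
move=> [mF fin _]; apply/integrableP; split.
  by apply/measurable_EFinP; exact: measurable_sqnorm.
have -> : (\int[@lebesgue_measure R]_(t in Dom) `|(EFin \o (fun t => sqnorm (F t))) t| =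
    \int[@lebesgue_measure R]_(t in Dom) (sqnorm (F t))%:E)%E.
  by apply: eq_integral => t _; rewrite gee0_abs// lee_fin sqnorm_ge0.
rewrite ltey; apply/eqP => Ioo; move: fin.
by rewrite /mint Ioo gt0_muley ?lte_fin ?invr_gt0 ?twopi_gt0.
Qed.

Lemma H2_mul_conj_integrable F G : H2 F -> H2 G ->
  circle_Cintegrable (fun t => F t * conjc (G t)).
Proof.
move=> hF hG; have iF := H2_sqnorm_integrable hF; have iG := H2_sqnorm_integrable hG.
have [mR mI] : cmeasurable (fun t => F t * conjc (G t)).
  by apply: cmeasurableM; [case: hF|apply: cmeasurable_conj; case: hG].
split; apply: circle_integrable_le (circle_integrableD iF iG) => // t _.
  rewrite ler_norml !reimE /sqnorm; move: (F t) (G t) => [a b] [c d] /=.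
  have := sqr_ge0 (a + c); have := sqr_ge0 (a - c).
  have := sqr_ge0 (b + d); have := sqr_ge0 (b - d).
  by move=> *; apply/andP; split; nra.
rewrite ler_norml !reimE /sqnorm; move: (F t) (G t) => [a b] [c d] /=.
have := sqr_ge0 (a + d); have := sqr_ge0 (a - d).
have := sqr_ge0 (b + c); have := sqr_ge0 (b - c).
by move=> *; apply/andP; split; nra.
Qed.

(* On a null set [u] is replaced by [1], so that [|u| = 1] everywhere. *)
Definition normalized (u : R -> R[i]) (t : R) : R[i] :=
  if sqnorm (u t) == 1 then u t else 1.

Lemma sqnorm_normalized u t : sqnorm (normalized u t) = 1.
Proof. by rewrite /normalized; case: ifPn => [/eqP|_]; rewrite ?sqnorm1. Qed.

Lemma bounded_normalized u : cmeasurable u -> bounded_Cmfun (normalized u).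
Proof.
move=> mu; have [mR mI] := mu.
have mb : measurable_fun Dom (fun t => sqnorm (u t) == 1).
  exact: (measurable_fun_eqr (measurable_sqnorm mu) (measurable_cst (1 : R))).
have bd (x : R) : x ^+ 2 <= 1 -> `|x| <= 1 by rewrite -real_normK ?num_real// expr_le1.
split; split.
- rewrite (_ : (fun t => _) =
    fun t => if sqnorm (u t) == 1 then complex.Re (u t) else 1); last first.
    by apply/funext => t; rewrite /normalized; case: ifP.
  apply: measurable_fun_if => //.
  by apply: measurable_funS mR.
- exists 1 => t _; apply: bd; rewrite -(sqnorm_normalized u t); exact: Re_sqr_le.
- rewrite (_ : (fun t => _) =
    fun t => if sqnorm (u t) == 1 then complex.Im (u t) else 0); last first.
    by apply/funext => t; rewrite /normalized; case: ifP.
  apply: measurable_fun_if => //.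
  by apply: measurable_funS mI.
- exists 1 => t _; apply: bd; rewrite -(sqnorm_normalized u t); exact: Im_sqr_le.
Qed.

Lemma ae_normalized u : inner_fun u -> ae_T (fun t => u t = normalized u t).
Proof.
by move=> [_]; apply: ae_T_imp => t _ ut; rewrite /normalized ut eqxx.
Qed.

Lemma analytic_normalized u : inner_fun u -> analytic (normalized u).
Proof.
move=> iu n n0; have [[mu _ /(_ n n0) <-] _] := iu.
have mX := bounded_cmeasurable (bounded_CmfunX n (@bounded_Cmfun_expi R)).
apply: ae_eq_mCint; [|exact: cmeasurableM|].
  by apply: cmeasurableM => //; exact/bounded_cmeasurable/bounded_normalized.
by apply: ae_T_imp (ae_normalized iu) => t _ <-.
Qed.

Lemma ext_normalized u w : inner_fun u -> sqnorm w < 1 ->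
  ext (normalized u) w = ext u w.
Proof.
move=> iu w1; have [[mu _ _] _] := iu.
have mP := bounded_cmeasurable (bounded_Cmfun_real (bounded_poisson w1)).
apply: ae_eq_mCint; [|exact: cmeasurableM|].
  by apply: cmeasurableM => //; exact/bounded_cmeasurable/bounded_normalized.
by apply: ae_T_imp (ae_normalized iu) => t _ <-.
Qed.

Lemma nonconstant_normalized u : inner_fun u -> nonconstant u ->
  nonconstant (normalized u).
Proof.
move=> iu ncu [c uc]; apply: ncu; exists c.
by apply: ae_T_imp2 (ae_normalized iu) uc => t _ ->.
Qed.

(** [u] enters the definition of the Clark measures only through its Poisson integral, which ignores
    null sets; the measures themselves are unchanged. *)
Lemma clark_family_normalized u sigma : inner_fun u -> clark_family u sigma ->
  clark_family (normalized u) sigma.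
Proof. by move=> iu clark a Da z z1; rewrite ext_normalized// clark. Qed.

(** * Inner products with the two resolvents *)

Lemma ip_conj F G : H2 F -> H2 G -> ip G F = conjc (ip F G).
Proof.
move=> hF hG; rewrite -mCint_conj; last exact: H2_mul_conj_integrable.
by apply: eq_mCint => t _; apply: complex_ext; rewrite !reimE; ring.
Qed.

Lemma resolvent_adj_ip u lam f y z : inner_fun u -> H2 f ->
  resolvent_adj u lam f y -> resolvent u lam f z -> ip y f = ip f z.
Proof.
move=> iu hf [hy adj] [hz res]; rewrite -(adj _ hz).
have [[mu _ _] _] := iu; have bu := bounded_normalized mu.
have iyz := H2_mul_conj_integrable hy hz.
have my : cmeasurable y by case: hy.
have mz : cmeasurable z by case: hz.
have mf : cmeasurable f by case: hf.
(* [u] is bounded only almost everywhere. With [normalized u] the integrand becomes a bounded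
   function times the integrable y conj(z), so linearity of the integral applies. *)
have -> : ip y (fun t => u t * z t) =
    mCint (fun t => conjc (normalized u t) * (y t * conjc (z t))).
  apply: ae_eq_mCint.
  - by apply: cmeasurableM => //; apply: cmeasurable_conj; exact: cmeasurableM.
  - apply: cmeasurableM; first exact/cmeasurable_conj/bounded_cmeasurable.
    by apply: cmeasurableM => //; apply: cmeasurable_conj.
  - apply: ae_T_imp (ae_normalized iu) => t _ <-; rewrite conjcM; ring.
have iuyz := circle_CintegrableM (bounded_Cmfun_conj bu) iyz.
rewrite -mCintZ// -mCintB//; last first.
  exact: (circle_CintegrableM (bounded_Cmfun_cst lam) iuyz).
have mL : cmeasurable (fun=> lam) by exact/bounded_cmeasurable/bounded_Cmfun_cst.
apply: ae_eq_mCint.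
- by apply: cmeasurableM => //; exact: cmeasurable_conj.
- apply: cmeasurableB; first by apply: cmeasurableM => //; exact: cmeasurable_conj.
  apply: cmeasurableM => //; apply: cmeasurableM.
    exact/cmeasurable_conj/bounded_cmeasurable.
  by apply: cmeasurableM => //; exact: cmeasurable_conj.
- apply: ae_T_imp2 (ae_normalized iu) res => t _ <- <-.
  by apply: complex_ext; rewrite !reimE; ring.
Qed.

(** The integrands already agree almost everywhere: z conj(f) = |f|^2 / (1 - conj(lam) u), and
    [poissonE] at the point u(t) is multiplied by |f|^2. *)
Lemma resolvent_ip u lam f z : inner_fun u -> H2 f -> sqnorm lam < 1 ->
  resolvent u lam f z ->
  2 * complex.Re (ip z f) - mRint (fun t => sqnorm (f t)) =
  mRint (fun t => poisson_comp (normalized u) lam t * sqnorm (f t)).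
Proof.
move=> iu hf l1 [hz res]; have [[mu _ _] _] := iu.
have [iR _] := H2_mul_conj_integrable hz hf.
have i2 := H2_sqnorm_integrable hf.
have bC := @bounded_poisson_comp _ _ (bounded_normalized mu)
  (fun t _ => sqnorm_normalized u t) lam l1.
rewrite -mRintZ// -mRintB//; last exact: circle_integrableZ.
have mf : cmeasurable f by case: hf.
have mz : cmeasurable z by case: hz.
have mzf : cmeasurable (fun t => z t * conjc (f t)).
  by apply: cmeasurableM => //; apply: cmeasurable_conj.
have ms := measurable_sqnorm mf.
apply: ae_eq_mRint.
- by apply: measurable_funB => //; apply: measurable_funM => //; exact: mzf.1.
- by apply: measurable_funM => //; exact: bC.1.
apply: ae_T_imp2 (ae_normalized iu) res => t _ ->.
set v := normalized u t => zf.
have v1 : sqnorm v = 1 by exact: sqnorm_normalized.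
have nz : 1 - conjc lam * v != 0.
  by apply/one_sub_neq0/sqnorm_mul_lt1; rewrite ?sqnorm_conj ?v1.
have -> : z t * conjc (f t) = (1 - conjc lam * v)^-1 * (sqnorm (f t))%:C%C.
  rewrite -mul_conjcE mulrA; congr (_ * _).
  by apply: (mulfI nz); rewrite mulVKf// -zf; ring.
by rewrite /poisson_comp -/v poissonE// !reimE /=; ring.
Qed.

End almost_everywhere.

Unset Implicit Arguments.

(** The left side of the identity is <K_lam(T_u) f, f>, with [y] and [z] the two resolvents applied
    to [f]. A finite positive measure on the circle is determined by its Poisson integrals, so
    equality for all [lam] identifies mu_{T_u,f} with h dm. Finiteness of [mint h] makes h dm a
    finite measure and, P_lam being bounded, makes [fine] harmless. *)
Theorem theorem5p1 (R : realType) (u : R -> R[i])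
    (sigma : R -> {measure set R -> \bar R}) (f : R -> R[i]) :
  inner_fun u -> nonconstant u -> clark_family u sigma -> H2 f ->
  let h := fun a : R => (\int[sigma a]_(t in Dom) (sqnorm (f t))%:E)%E in
  (mint h < +oo)%E /\
  forall lam : R[i], sqnorm lam < 1 ->
  forall y z : R -> R[i], resolvent_adj u lam f y -> resolvent u lam f z ->
    ip y f + ip z f - ip f f =
    ((fine (mint (fun a => ((poisson lam a)%:E * h a)%E)))%:C)%C.
Proof.
move=> iu ncu clark hf h.
have [[mu _ _] _] := iu; have [mf finf _] := hf.
have bu := bounded_normalized mu.
have u1 t : Dom t -> sqnorm (normalized u t) = 1 by move=> _; exact: sqnorm_normalized.
have disint := clark_disintegration bu u1 (analytic_normalized iu)
  (nonconstant_normalized iu ncu) (clark_family_normalized iu clark)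
  (measurable_sqnorm mf) (fun t _ => sqnorm_ge0 (f t)).
split.
  (* The total mass is the case [lam = 0], where both P_0 and P_0(u) are 1; it equals ||f||^2. *)
  have -> : mint h = mint (fun a => (poisson 0 a)%:E * h a)%E.
    by congr (_ * _)%E; apply: eq_integral => a _; rewrite poisson0 mul1e.
  rewrite disint ?sqnorm0//; apply: le_lt_trans finf.
  rewrite le_eqVlt; apply/orP; left; apply/eqP; congr (_ * _)%E.
  apply: eq_integral => t; rewrite inE => Dt; congr EFin.
  by rewrite /poisson_comp sqnorm0 !subr0 u1// divr1 mul1r.
move=> lam l1 y z adj res.
have hz : H2 z by case: res.
rewrite (resolvent_adj_ip iu hf adj res) (ip_conj hz hf) disint//.
rewrite -[mint _]/(mint (EFin \o fun t => poisson_comp (normalized u) lam t * sqnorm (f t))).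
rewrite -mRint_fin; last first.
  by apply: circle_integrableM; [exact: bounded_poisson_comp|exact: H2_sqnorm_integrable].
rewrite /= -(resolvent_ip iu hf l1 res).
have -> : ip f f = (mRint (fun t => sqnorm (f t)))%:C%C.
  rewrite /ip; under [X in mCint X]eq_fun do rewrite mul_conjcE.
  by apply: complex_ext => //=; exact: mRint_cst.
by apply: complex_ext; rewrite !reimE /=; ring.
Qed.
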